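(* Let $k$ be a field, $\vec{x}=x_1,\ldots,x_n$, $\vec{y}=y_1,\ldots,y_{n'}$, $R=k[[\vec{x},\vec{y}]]$, $I\subseteq(\vec{x})$ an ideal of $k[[\vec{x}]]$, $I'\subseteq(\vec{y})$ an ideal of $k[[\vec{y}]]$, and $F=\frac{k[[\vec{x}]]}{I}\times_k\frac{k[[\vec{y}]]}{I'}$, regarded as an $R$-module via $F\cong R/(IR+(\vec{x}\vec{y})+I'R)$. Let $p=\dim_k\big((I+(\vec{x})^2)/(\vec{x})^2\big)$ and $q=\dim_k\big((I'+(\vec{y})^2)/(\vec{y})^2\big)$. Then the Poincaré series satisfy $$\frac{P_F^R(t)-(1+t)^{n'}P_{R/IR}^R(t)-(1+t)^{n}P_{R/I'R}^R(t)+(1+t)^{n+n'}}{\big((1+t)^{n}-(1+t)^p\big)\big((1+t)^{n'}-(1+t)^q\big)}=\frac{t+1}{t}.$$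
   Context: The fiber product $S\times_k T$ of local rings with common residue field $k$ is $\{(s,t)\in S\times T:\pi_S(s)=\pi_T(t)\}$ where $\pi_S,\pi_T$ are the natural surjections onto $k$. $(\vec{x}\vec{y})$ is the ideal generated by all $x_iy_j$. For a finitely generated $R$-module $M$, $\beta_i^R(M)=\dim_k\operatorname{Tor}_i^R(M,k)$ and $P_M^R(t)=\sum_{i\ge0}\beta_i^R(M)t^i$ is its Poincaré series. *)

(* Defs.v *)
From HB Require Import structures.
From mathcomp Require Import all_boot all_order all_algebra.
Set Implicit Arguments.
Unset Strict Implicit.
Unset Printing Implicit Defensive.
Import GRing.Theory.
Local Open Scope ring_scope.

Definition mi (N : nat) := {ffun 'I_N -> nat}.
Definition mi0 (N : nat) : mi N := [ffun => 0%N].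

(* formal power series k[[z_0,...,z_{N-1}]]: coefficient functions *)
Definition PS (k : fieldType) (N : nat) := mi N -> k.

Section PSops.
Variables (k : fieldType) (N : nat).

Definition ps0 : PS k N := fun _ => 0.
Definition psadd (f g : PS k N) : PS k N := fun a => f a + g a.
Definition psscale (c : k) (f : PS k N) : PS k N := fun a => c * f a.
(* Cauchy product: (fg)_a = sum_{b <= a} f_b g_{a-b} *)
Definition psmul (f g : PS k N) : PS k N := fun a =>
  \sum_(b : {dffun forall i : 'I_N, 'I_(a i).+1})
     f [ffun i => (b i : nat)] * g [ffun i => (a i - b i)%N].
Definition psX (i : 'I_N) : PS k N :=
  fun a => if a == [ffun j => nat_of_bool (j == i)] then 1 else 0.
Definition pssum m (F : 'I_m -> PS k N) : PS k N := \big[psadd/ps0]_(j < m) F j.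
Definition const_term (f : PS k N) : k := f (mi0 N).

Definition is_ideal (I : PS k N -> Prop) :=
  [/\ I ps0, (forall f g, I f -> I g -> I (psadd f g))
    & (forall r f, I f -> I (psmul r f))].
Definition ideal_gen (S : PS k N -> Prop) : PS k N -> Prop :=
  fun f => exists m (r s : 'I_m -> PS k N),
    (forall j, S (s j)) /\ f = pssum (fun j => psmul (r j) (s j)).
Definition ideal_add (A B : PS k N -> Prop) : PS k N -> Prop :=
  fun f => exists a b, [/\ A a, B b & f = psadd a b].
Definition max_ideal := ideal_gen (fun f => exists i, f = psX i).
Definition max_ideal_sq :=
  ideal_gen (fun f => exists i j, f = psmul (psX i) (psX j)).

(* dim_k (A/B) = d, for k-subspaces B <= A: there are d elements of A
   linearly independent modulo B, but not d+1. *)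
Definition indep_mod (A B : PS k N -> Prop) (m : nat) :=
  exists v : 'I_m -> PS k N, (forall j, A (v j)) /\
    forall c : 'I_m -> k, B (pssum (fun j => psscale (c j) (v j))) ->
      forall j, c j = 0.
Definition quot_dim (A B : PS k N -> Prop) (d : nat) :=
  indep_mod A B d /\ ~ indep_mod A B d.+1.

Definition rowmul (m l : nat) (v : 'I_m -> PS k N) (D : 'I_m -> 'I_l -> PS k N)
  : 'I_l -> PS k N := fun j => pssum (fun i => psmul (v i) (D i j)).

(* A free resolution ... -> F_2 -> F_1 -> F_0 = R -> R/J -> 0 of the
   cyclic module R/J; F_i = R^(rank i), d i : F_(i+1) -> F_i (row convention). *)
Unset Implicit Arguments.
Record free_res (J : PS k N -> Prop) := FreeRes {
  fr_rank : nat -> nat;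
  fr_d : forall i, 'I_(fr_rank i.+1) -> 'I_(fr_rank i) -> PS k N;
  fr_rank0 : fr_rank 0 = 1%N;
  fr_aug : forall f, J f <-> exists v, forall j, rowmul v (fr_d 0%N) j = f;
  fr_exact : forall i (u : 'I_(fr_rank i.+1) -> PS k N),
    (forall j, rowmul u (fr_d i) j = ps0) <->
    exists w, forall j, u j = rowmul w (fr_d i.+1) j
}.
Set Implicit Arguments.
Arguments fr_rank {J}.
Arguments fr_d {J}.

(* F (x)_R k : the differentials reduced modulo the maximal ideal *)
Definition fr_red J (r : free_res J) i : 'M[k]_(fr_rank r i.+1, fr_rank r i) :=
  \matrix_(a, b) const_term (fr_d r i a b).

(* beta_i = dim_k Tor_i^R(R/J, k) = dim_k H_i(F (x)_R k) *)
Definition betti J (r : free_res J) (i : nat) : nat :=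
  match i with
  | 0 => (fr_rank r 0%N - \rank (fr_red r 0%N))%N
  | i'.+1 => (\rank (kermx (fr_red r i')) - \rank (fr_red r i'.+1))%N
  end.

End PSops.

(* R = k[[x,y]] with x = first n variables, y = last n' variables *)
Section Fiber.
Variables (k : fieldType) (n n' : nat).

Definition ext_x (f : PS k n) : PS k (n + n') := fun a =>
  if [forall j : 'I_n', a (rshift n j) == 0%N]
  then f [ffun i => a (lshift n' i)] else 0.
Definition ext_y (f : PS k n') : PS k (n + n') := fun a =>
  if [forall i : 'I_n, a (lshift n' i) == 0%N]
  then f [ffun j => a (rshift n j)] else 0.

Definition ext_ideal_x (I : PS k n -> Prop) : PS k (n + n') -> Prop :=
  ideal_gen (fun f => exists g, I g /\ f = ext_x g).
Definition ext_ideal_y (I' : PS k n' -> Prop) : PS k (n + n') -> Prop :=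
  ideal_gen (fun f => exists g, I' g /\ f = ext_y g).
Definition xy_ideal : PS k (n + n') -> Prop :=
  ideal_gen (fun f => exists (i : 'I_n) (j : 'I_n'),
     f = psmul (psX k (lshift n' i)) (psX k (rshift n j))).
Definition fiber_ideal I I' :=
  ideal_add (ideal_add (ext_ideal_x I) xy_ideal) (ext_ideal_y I').
End Fiber.

Arguments free_res {k N}.
Arguments fr_rank {k N J}.
Arguments fr_d {k N J}.

Definition ser := nat -> int.
Definition ser_mul (a b : ser) : ser := fun i => \sum_(j < i.+1) a j * b (i - j)%N.
Definition poly_ser (P : {poly int}) : ser := fun i => P`_i.
Definition poincare (k : fieldType) N (J : PS k N -> Prop) (r : free_res J) : ser :=
  fun i => (betti r i)%:Z.

(* Main.v *)
From HB Require Import structures.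
Require Import Defs.
From mathcomp Require Import all_boot all_order all_algebra all_fingroup.
From mathcomp Require Import boolp zify ring.
Set Implicit Arguments.
Unset Strict Implicit.
Unset Printing Implicit Defensive.
Import GRing.Theory.
Local Open Scope ring_scope.

(** Write S = R/(IR + (y)), T = R/(I'R + (x)), and k for the residue field of R.
    The fiber product is the kernel of the difference map S + T -> k, so its
    Betti numbers follow from those of S, T and k once one knows the image of
    Tor(S, k) + Tor(T, k) in Tor(k, k).  Since y is regular on R/IR, resolving S
    costs a factor (1+t)^n', and symmetrically for T.

    To compute the image, choose a regular system of parameters z of R made of p
    elements of I, n - p linear forms in x, q elements of I' and n' - q linear
    forms in y, such that I is spanned by its p chosen elements modulo (x)^2,
    and likewise for I'.  The Koszul complex on z resolves k and is
    minimal, so Tor(k, k) is the exterior algebra on z.  The image of Tor(S, k)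
    is the exterior algebra on the z_i lying in the ideal of S: it contains it
    because the Koszul complex on these z_i maps to any resolution of S, and for
    any other z_j the map S -> k factors through R/(z_i (i <> j), z_j^2), whose
    Koszul resolution maps to the one of k by z_j on the basis vectors involving
    j.  The cokernel then has Hilbert series
    ((1+t)^n - (1+t)^p) ((1+t)^n' - (1+t)^q). *)

(** * Complexes of free modules *)

(** The ratio (t+1)/t comes from the connecting map, which shifts degrees by one. Let w_i be the
    dimension of the image in Tor_i(k, k) and c_i = C(n+n', i) - w_i that of the cokernel. Exactness
    gives beta_i(F) - beta_i(S) - beta_i(T) + C(n+n', i) = c_i + c_(i+1), and since c_0 = 0,
    multiplication by t turns the right-hand side into (1+t) times the series of the c_i.

    The given resolutions need not be minimal, so maps on Tor are compared through homotopies. The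
    Koszul complex on z is minimal, and a null-homotopic map into it vanishes on reduced cycles.

    The obstacle is regularity. It is defined one element at a time in a fixed order, whereas z
    arises from the variables by an invertible matrix and any one of its entries must be squared.
    Both operations pass through the vanishing of the first Koszul homology, which does not depend
    on a choice of generators; the way back to regular sequences uses completeness. *)

Lemma dep_choice (T : nat -> Type) (P : forall i, T i -> Prop)
    (S : forall i, T i -> T i.+1 -> Prop) (x0 : T 0%N) :
  P 0%N x0 -> (forall i x, P i x -> exists y, S i x y /\ P i.+1 y) ->
  exists f : forall i, T i, f 0%N = x0 /\ forall i, S i (f i) (f i.+1).
Proof.
move=> P0 step.
have step' i (x : {x : T i | P i x}) :
    {y : {y : T i.+1 | P i.+1 y} | S i (sval x) (sval y)}.
  have [y [Sy Py]] := cid (step i (sval x) (svalP x)).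
  exact: (exist _ (exist _ y Py) Sy).
pose F := fix F i : {x : T i | P i x} :=
  match i with 0 => exist _ x0 P0 | i.+1 => sval (step' i (F i)) end.
by exists (fun i => sval (F i)); split=> // i; exact: svalP (step' i (F i)).
Qed.

(* The module one degree lower, zero below degree 0; with it cones and cycles
   are described uniformly in all degrees. *)
Definition prev_rk (r : nat -> nat) i : nat := if i is j.+1 then r j else 0%N.

(* Free complexes ending in degree 0; vectors are rows, as in [free_res]. *)
Record cplx (R : pzRingType) := Cplx {
  rk : nat -> nat;
  dif : forall i, 'M[R]_(rk i.+1, rk i)
}.

Definition prev_dif (R : pzRingType) (r : nat -> nat)
    (D : forall i, 'M[R]_(r i.+1, r i)) i : 'M[R]_(r i, prev_rk r i) :=
  match i return 'M[R]_(r i, prev_rk r i) with 0 => 0 | j.+1 => D j end.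

Section Complexes.
Variable R : comNzRingType.
Implicit Types C D E : cplx R.

Definition is_cplx C := forall i, dif C i *m prev_dif (dif C) i = 0.
(** Exactness in positive degrees only: the homology in degree 0 is the module resolved. *)
Definition acyclic C := forall i (u : 'rV_(rk C i.+1)),
  u *m dif C i = 0 -> exists w, u = w *m dif C i.+1.
Definition in_im C i (u : 'rV_(rk C i)) := exists w, u = w *m dif C i.

Definition chain C D (f : forall i, 'M[R]_(rk C i, rk D i)) :=
  forall i, f i.+1 *m dif D i = dif C i *m f i.
Definition null_htpy C D (f : forall i, 'M[R]_(rk C i, rk D i)) :=
  exists h : forall i, 'M[R]_(rk C i, rk D i.+1),
    f 0%N = h 0%N *m dif D 0 /\
    forall i, f i.+1 = dif C i *m h i + h i.+1 *m dif D i.+1.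

Lemma row_lift m n p (A : 'M[R]_(m, n)) (B : 'M_(p, n)) :
  (forall i, exists w, row i A = w *m B) -> exists W, A = W *m B.
Proof.
move/fin_all_exists=> [w wE]; exists (\matrix_i w i).
by apply/row_matrixP=> i; rewrite wE row_mul rowK.
Qed.

Lemma cplx_dd C i : is_cplx C -> dif C i.+1 *m dif C i = 0.
Proof. by move=> /(_ i.+1). Qed.

Lemma acyclic_lift C i m (u : 'M_(m, rk C i.+1)) :
  acyclic C -> u *m dif C i = 0 -> exists w, u = w *m dif C i.+1.
Proof. by move=> aC u0; apply: row_lift => j; apply: aC; rewrite -row_mul u0 row0. Qed.

(** Comparison theorem, existence: the condition on [f0] says that it induces a map on degree 0
    homology, and exactness of [D] extends it one degree at a time. *)
Lemma lift_chain C D (f0 : 'M_(rk C 0, rk D 0)) :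
  is_cplx C -> acyclic D -> (forall w, in_im (w *m dif C 0 *m f0)) ->
  exists f, f 0%N = f0 /\ @chain C D f.
Proof.
move=> cC aD f0P.
pose P i (f : 'M_(rk C i, rk D i)) := exists g, dif C i *m f = g *m dif D i.
pose S i (f : 'M_(rk C i, rk D i)) (g : 'M_(rk C i.+1, rk D i.+1)) :=
  g *m dif D i = dif C i *m f.
apply: (@dep_choice (fun i => 'M_(rk C i, rk D i)) P S f0).
  by apply: row_lift => i; rewrite rowE mulmxA; exact: f0P.
move=> i f [g fE]; exists g; split=> //.
by apply: acyclic_lift => //; rewrite -mulmxA -fE mulmxA cplx_dd // mul0mx.
Qed.

(** Comparison theorem, uniqueness: a chain map inducing zero on degree 0 homology is
    null-homotopic. *)
Lemma chain_null C D (f : forall i, 'M_(rk C i, rk D i)) :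
  is_cplx C -> acyclic D -> chain f ->
  (forall w : 'rV_(rk C 0), in_im (w *m f 0%N)) -> null_htpy f.
Proof.
move=> cC aD fC f0P.
have [h0 h0E] : exists h0, f 0%N = h0 *m dif D 0.
  by apply: row_lift => i; rewrite rowE; exact: f0P.
pose P i (h : 'M_(rk C i, rk D i.+1)) :=
  dif C i *m f i = dif C i *m h *m dif D i.
pose S i (h : 'M_(rk C i, rk D i.+1)) (h' : 'M_(rk C i.+1, rk D i.+2)) :=
  f i.+1 = dif C i *m h + h' *m dif D i.+1.
have [||h [hE hS]] := @dep_choice (fun i => 'M_(rk C i, rk D i.+1)) P S h0.
- by rewrite /P h0E mulmxA.
- move=> i h hP.
  have [|g gE] := @acyclic_lift D i _ (f i.+1 - dif C i *m h) aD.
    by rewrite mulmxBl fC hP subrr.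
  exists g; rewrite /S /P -gE addrC subrK; split=> //.
  by rewrite -mulmxA -gE mulmxBr mulmxA cplx_dd // mul0mx subr0.
by exists h; rewrite hE.
Qed.

Lemma chain_comp C D E (f : forall i, 'M_(rk C i, rk D i))
  (g : forall i, 'M_(rk D i, rk E i)) :
  chain f -> chain g -> @chain C E (fun i => f i *m g i).
Proof. by move=> fC gC i; rewrite -mulmxA gC mulmxA fC mulmxA. Qed.

Lemma chain_sub C D (f g : forall i, 'M_(rk C i, rk D i)) :
  chain f -> chain g -> chain (fun i => f i - g i).
Proof. by move=> fC gC i; rewrite mulmxBl mulmxBr fC gC. Qed.

Definition cone C D (f : forall i, 'M[R]_(rk C i, rk D i)) : cplx R :=
  @Cplx R (fun i => (rk D i + prev_rk (rk C) i)%N)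
   (fun i => block_mx (dif D i) 0 (f i) (- prev_dif (dif C) i)).

Definition dsum C D : cplx R :=
  @Cplx R (fun i => (rk C i + rk D i)%N)
   (fun i => block_mx (dif C i) 0 0 (dif D i)).

Lemma cone_cplx C D (f : forall i, 'M_(rk C i, rk D i)) :
  is_cplx C -> is_cplx D -> chain f -> is_cplx (cone f).
Proof.
move=> cC cD fC [|i] /=; first exact: mulmx0.
rewrite mulmx_block !mul0mx !mulmx0 cplx_dd // fC mulNmx subrr !addr0 add0r.
by rewrite mulNmx mulmxN opprK cC block_mx0.
Qed.

(** The degree 1 homology of the cone contains the kernel of the map induced on degree 0 homology,
    hence the injectivity hypothesis; in higher degrees acyclicity of [C] and [D] is enough. *)
Lemma cone_acyclic C D (f : forall i, 'M_(rk C i, rk D i)) :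
  acyclic C -> acyclic D -> chain f ->
  (forall u : 'rV_(rk C 0), in_im (u *m f 0%N) -> in_im u) -> acyclic (cone f).
Proof.
move=> aC aD fC f0P i u; rewrite -(hsubmxK u) /= mul_row_block mulmx0 add0r.
set u1 := lsubmx u; set u2 := rsubmx u; rewrite -[X in _ = X](@row_mx0 _ 1).
move=> /eq_row_mx[e1]; rewrite mulmxN => /eqP; rewrite oppr_eq0 => /eqP e2.
have [w2 w2E] : in_im u2.
  case: i u u1 u2 e1 e2 => [|i] u u1 u2 e1 e2; last exact: aC.
  apply: f0P; exists (- u1); rewrite mulNmx; apply/eqP.
  by rewrite -addr_eq0 addrC e1.
have [|w1 w1E] := aD i (u1 + w2 *m f i.+1).
  by rewrite mulmxDl -mulmxA fC mulmxA -w2E.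
exists (row_mx w1 (- w2)); rewrite mul_row_block mulmx0 add0r mulmxN !mulNmx.
by rewrite -w1E addrK opprK -w2E.
Qed.

Lemma dsum_cplx C D : is_cplx C -> is_cplx D -> is_cplx (dsum C D).
Proof.
move=> cC cD [|i] /=; first exact: mulmx0.
by rewrite mulmx_block !mul0mx !mulmx0 !cplx_dd // !addr0 block_mx0.
Qed.

Lemma dsum_acyclic C D : acyclic C -> acyclic D -> acyclic (dsum C D).
Proof.
move=> aC aD i u; rewrite -(hsubmxK u) /= mul_row_block !mulmx0 add0r addr0.
rewrite -[X in _ = X](@row_mx0 _ 1) => /eq_row_mx[/aC[w1 e1] /aD[w2 e2]].
exists (row_mx w1 w2); rewrite mul_row_block !mulmx0 add0r addr0 -e1 -e2.
by rewrite hsubmxK.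
Qed.

End Complexes.

(** * Ranks and homology over a field *)

Section FieldComplexes.
Variable k : fieldType.
Implicit Types C D : cplx k.

Definition cyc C i := kermx (prev_dif (dif C) i).
Definition hdim C i := (\rank (cyc C i) - \rank (dif C i))%N.

Lemma rank_prev C i : (\rank (prev_dif (dif C) i) + \rank (cyc C i) = rk C i)%N.
Proof. by rewrite mxrank_ker subnKC // rank_leq_row. Qed.

Lemma hdim_add C i : is_cplx C ->
  (hdim C i + \rank (dif C i) = \rank (cyc C i))%N.
Proof. by move=> cC; rewrite subnK //; apply: mxrankS; apply/sub_kermxP. Qed.

(** Rank-nullity for [F] restricted to the row space of [Z], where its kernel is the row space of
    [B]. *)
Lemma rank_quot m n p q (Z : 'M[k]_(m, n)) (F : 'M_(n, p)) (B : 'M_(q, n)) :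
  (B <= Z)%MS -> (forall u : 'rV_n, (u <= Z)%MS -> (u *m F == 0) = (u <= B)%MS) ->
  (\rank (Z *m F) + \rank B)%N = \rank Z.
Proof.
move=> BZ uP; rewrite -(mxrank_mul_ker Z F); congr (_ + _)%N.
apply/eqmx_rank/andP; split.
  rewrite sub_capmx BZ /=; apply/row_subP=> i; apply/sub_kermxP/eqP.
  by rewrite uP ?row_sub // (submx_trans (row_sub i B)).
apply/row_subP=> i; have := row_sub i (Z :&: kermx F)%MS.
by rewrite sub_capmx => /andP[/uP <- /sub_kermxP->].
Qed.

(** Project the row space onto the last [q] coordinates: the image is that of [P], and the kernel
    consists of the rows of [A] together with u F for u P = 0. In a cone the latter are the images
    of cycles. *)
Lemma rank_block_ltriangle m n p q (A : 'M[k]_(m, n)) (F : 'M_(p, n)) (P : 'M_(p, q)) :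
  \rank (block_mx A 0 F (- P)) = (\rank P + \rank (kermx P *m F + A)%MS)%N.
Proof.
set M := block_mx _ _ _ _; set B := (_ + _)%MS.
pose pr : 'M[k]_(n + q, q) := col_mx 0 1%:M.
have MP : M *m pr = col_mx 0 (- P).
  by rewrite mul_block_col !mulmx0 !mulmx1 !add0r.
have rMP : \rank (M *m pr) = \rank P.
  rewrite MP -addsmxE; apply/eqmx_rank/andP; split.
    by rewrite addsmx_sub sub0mx eqmx_opp submx_refl.
  by rewrite (submx_trans _ (addsmxSr _ _)) // eqmx_opp submx_refl.
pose in1 : 'M[k]_(n, n + q) := row_mx 1%:M 0.
have fin1 : row_free in1.
  by apply/row_freeP; exists (col_mx 1%:M 0); rewrite mul_row_col mulmx1 mul0mx addr0.
have in1E l (u : 'M_(l, n)) : u *m in1 = row_mx u 0.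
  by rewrite mul_mx_row mulmx1 mulmx0.
rewrite -(mxrankMfree B fin1) -rMP.
suff <- : (\rank (M *m pr) + \rank (B *m in1))%N = \rank M by [].
apply: rank_quot.
  rewrite /B (eqmxMr _ (addsmxE _ _)) mul_col_mx -addsmxE addsmx_sub !in1E.
  apply/andP; split.
    have -> : row_mx (kermx P *m F) 0 = row_mx 0 (kermx P) *m M.
      by rewrite mul_row_block mulmxN (mulmx_ker P) oppr0 2!mul0mx 2!add0r.
    exact: submxMl.
  have -> : row_mx A 0 = row_mx 1%:M 0 *m M.
    by rewrite mul_row_block mul1mx mulmx0 2!mul0mx 2!addr0.
  exact: submxMl.
move=> _ /submxP[w ->]; rewrite -mulmxA MP -(hsubmxK w).
set w1 := lsubmx w; set w2 := rsubmx w.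
rewrite mul_row_col mulmx0 add0r mulmxN oppr_eq0 mul_row_block mulmx0 add0r mulmxN.
apply/eqP/idP=> [w2P|].
  rewrite w2P oppr0 -in1E.
  apply: submxMr; rewrite addmx_sub //.
    by rewrite (submx_trans _ (addsmxSr _ _)) // submxMl.
  by rewrite (submx_trans _ (addsmxSl _ _)) // submxMr //; apply/sub_kermxP.
move=> /submxP[v]; rewrite mulmxA in1E => /eq_row_mx[_ /eqP].
by rewrite oppr_eq0 => /eqP.
Qed.

Lemma rank_cone_dif C D (f : forall i, 'M[k]_(rk C i, rk D i)) i :
  \rank (dif (cone f) i) =
  (\rank (prev_dif (dif C) i) + \rank (cyc C i *m f i + dif D i)%MS)%N.
Proof. exact: rank_block_ltriangle. Qed.

End FieldComplexes.

(** * Complexes resolving cyclic modules *)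

Section Cyclic.
Variable R : comNzRingType.
Implicit Types C D : cplx R.

(* [rk C 0] is 1 only propositionally, hence [const_mx]. *)
Definition aug_ideal C (r : R) := @in_im R C 0 (const_mx r).

Lemma rank1_const n (u : 'rV[R]_n) : n = 1%N -> exists r, u = const_mx r.
Proof.
by move=> n1; subst n; exists (u 0 0); apply/rowP=> i; rewrite mxE !ord1.
Qed.

Lemma rank1_mul m n p (r s : R) : n = 1%N ->
  (const_mx r : 'M_(m, n)) *m (const_mx s : 'M_(n, p)) = const_mx (r * s).
Proof. by move->; apply/matrixP=> i j; rewrite !mxE big_ord1 !mxE. Qed.

Lemma const1_id n : n = 1%N -> const_mx 1 = 1%:M :> 'M[R]_n.
Proof. by move->; apply/matrixP=> i j; rewrite !mxE !ord1. Qed.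

Lemma in_imD C i (u v : 'rV_(rk C i)) : in_im u -> in_im v -> in_im (u + v).
Proof. by move=> [a ->] [b ->]; exists (a + b); rewrite mulmxDl. Qed.

Lemma in_im0 C i : in_im (0 : 'rV_(rk C i)).
Proof. by exists 0; rewrite mul0mx. Qed.

(** An inclusion of ideals gives a surjection of cyclic modules; this is its lift. *)
Lemma lift_one C D : is_cplx C -> acyclic D -> rk C 0 = 1%N ->
  (forall r, aug_ideal C r -> aug_ideal D r) ->
  exists f : forall i, 'M_(rk C i, rk D i), f 0%N = const_mx 1 /\ chain f.
Proof.
move=> cC aD C1 CD; apply: lift_chain => // w.
have [r wE] := rank1_const (w *m dif C 0) C1.
by rewrite wE rank1_mul // mulr1; apply: CD; exists w.
Qed.

End Cyclic.

(** * Reduction to the residue field *)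

Section Reduction.
Variables (R : comNzRingType) (k : fieldType) (eps : {rmorphism R -> k}).
Implicit Types C D : cplx R.

Definition red C : cplx k := @Cplx k (rk C) (fun i => map_mx eps (dif C i)).
Definition minimal C := forall i, map_mx eps (dif C i) = 0.

Lemma prev_red C i : prev_dif (dif (red C)) i = map_mx eps (prev_dif (dif C) i).
Proof. by case: i => [|i] //=; rewrite map_mx0. Qed.

Lemma red_cplx C : is_cplx C -> is_cplx (red C).
Proof. by move=> cC i; rewrite prev_red -map_mxM cC map_mx0. Qed.

(** On a cycle, one of the two terms of the homotopy formula vanishes and the other is a
    boundary. *)
Lemma null_red C D (f : forall i, 'M_(rk C i, rk D i)) i m (u : 'M_(m, rk C i)) :
  null_htpy f -> u *m prev_dif (dif (red C)) i = 0 ->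
  (u *m map_mx eps (f i) <= map_mx eps (dif D i))%MS.
Proof.
move=> [h [h0 hS]]; case: i u => [|i] u u0 /=.
  by rewrite h0 map_mxM mulmxA submxMl.
by rewrite hS map_mxD !map_mxM mulmxDr !mulmxA u0 mul0mx add0r submxMl.
Qed.

Lemma null_sub_red C D (f g : forall i, 'M_(rk C i, rk D i)) i m (u : 'M_(m, rk C i)) :
  null_htpy (fun i => f i - g i) -> u *m prev_dif (dif (red C)) i = 0 ->
  (u *m map_mx eps (f i) - u *m map_mx eps (g i) <= map_mx eps (dif D i))%MS.
Proof. by move=> fg /(null_red fg); rewrite map_mxB mulmxBr. Qed.

Lemma cyc_dsum_mul (A B : cplx k) i p (F : 'M_(rk A i, p)) (G : 'M_(rk B i, p)) :
  (cyc (dsum A B) i *m col_mx F (- G) :=: cyc A i *m F + cyc B i *m G)%MS.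
Proof.
have cycE (u1 : 'rV_(rk A i)) (u2 : 'rV_(rk B i)) :
    (row_mx u1 u2 <= cyc (dsum A B) i)%MS = (u1 <= cyc A i)%MS && (u2 <= cyc B i)%MS.
  apply/sub_kermxP/andP; case: i F G u1 u2 => [|i] F G u1 u2 /=.
  - by move=> _; split; apply/sub_kermxP; exact: thinmx0.
  - rewrite mul_row_block !mulmx0 add0r addr0 -[X in _ = X](@row_mx0 _ 1).
    by case/eq_row_mx=> e1 e2; split; apply/sub_kermxP.
  - by move=> _; exact: thinmx0.
  by move=> [/sub_kermxP/= e1 /sub_kermxP/= e2];
    rewrite mul_row_block !mulmx0 e1 e2 !addr0 row_mx0.
apply/eqmxP/andP; split.
  apply/row_subP=> j; rewrite row_mul; have := row_sub j (cyc (dsum A B) i).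
  rewrite -(hsubmxK (row j _)) cycE mul_row_col mulmxN => /andP[c1 c2].
  rewrite addmx_sub // ?eqmx_opp.
    by rewrite (submx_trans _ (addsmxSl _ _)) // submxMr.
  by rewrite (submx_trans _ (addsmxSr _ _)) // submxMr.
rewrite addsmx_sub; apply/andP; split; apply/row_subP=> j; rewrite row_mul.
  have -> : row j (cyc A i) *m F = row_mx (row j (cyc A i)) 0 *m col_mx F (- G).
    by rewrite mul_row_col mul0mx addr0.
  by apply: submxMr; rewrite cycE row_sub sub0mx.
have -> : row j (cyc B i) *m G = row_mx 0 (- row j (cyc B i)) *m col_mx F (- G).
  by rewrite mul_row_col mul0mx add0r mulmxN mulNmx opprK.
by apply: submxMr; rewrite cycE eqmx_opp row_sub sub0mx.
Qed.

End Reduction.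

(** * The long exact sequence of the fiber product *)

Section FiberProduct.
Variables (R : comNzRingType) (k : fieldType) (eps : {rmorphism R -> k}).
Variables (D A B Q : cplx R).
Hypotheses (cD : is_cplx D) (cA : is_cplx A) (cB : is_cplx B) (cQ : is_cplx Q).
Hypotheses (aD : acyclic D) (aA : acyclic A) (aB : acyclic B) (aQ : acyclic Q).
Hypotheses (D1 : rk D 0 = 1%N) (A1 : rk A 0 = 1%N) (B1 : rk B 0 = 1%N) (Q1 : rk Q 0 = 1%N).
Hypothesis JD : forall r, aug_ideal D r <-> aug_ideal A r /\ aug_ideal B r.
Hypothesis JQ : forall r, aug_ideal Q r <->
  exists a b, [/\ aug_ideal A a, aug_ideal B b & r = a + b].
Hypothesis mQ : minimal eps Q.
Variables (phi : forall i, 'M[R]_(rk A i, rk Q i)) (psi : forall i, 'M[R]_(rk B i, rk Q i)).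
Hypotheses (phiC : chain phi) (psiC : chain psi).
Hypotheses (phi0 : phi 0%N = const_mx 1) (psi0 : psi 0%N = const_mx 1).

Let E := dsum A B.
Let cE : is_cplx E := dsum_cplx cA cB.
Let aE : acyclic E := dsum_acyclic aA aB.

(** Lifts the difference map from the sum of the two quotients to the residue module; [f0] is the
    diagonal embedding of the fiber product. *)
Let Phi i : 'M[R]_(rk E i, rk Q i) := col_mx (phi i) (- psi i).

Let PhiC : chain Phi.
Proof.
move=> i; rewrite /Phi /= mul_block_col !mul0mx addr0 add0r mul_col_mx phiC.
by rewrite mulNmx psiC mulmxN.
Qed.

Let f0 : 'M[R]_(rk D 0, rk E 0) := row_mx (const_mx 1) (const_mx 1).

Let in_E (a b : R) :
  @in_im R E 0 (row_mx (const_mx a) (const_mx b)) <-> aug_ideal A a /\ aug_ideal B b.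
Proof.
split=> [[w]|[[u uE] [v vE]]].
  rewrite -(hsubmxK w) mul_row_block !mulmx0 addr0 add0r => /eq_row_mx[e1 e2].
  by split; [exists (lsubmx w) | exists (rsubmx w)].
by exists (row_mx u v); rewrite mul_row_block !mulmx0 addr0 add0r uE vE.
Qed.

Let f0E r : (const_mx r : 'rV_(rk D 0)) *m f0 = row_mx (const_mx r) (const_mx r).
Proof. by rewrite mul_mx_row !rank1_mul // mulr1. Qed.

Let f_ex : exists f : forall i, 'M[R]_(rk D i, rk E i), f 0%N = f0 /\ chain f.
Proof.
apply: lift_chain => // w; have [r wE] := rank1_const (w *m dif D 0) D1.
rewrite wE f0E; apply/in_E; apply/JD; by exists w.
Qed.

(* The cone G of D -> A + B resolves the same module as Q; the formula is the long
   exact sequence of the cone, the two ranks being those of the maps from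
   Tor(A + B) to Tor(Q). *)
Lemma fiber_betti i :
  (hdim (red eps D) i
   + \rank (cyc (red eps A) i *m map_mx eps (phi i) + cyc (red eps B) i *m map_mx eps (psi
     i))%MS
   + \rank (cyc (red eps A) i.+1 *m map_mx eps (phi i.+1)
            + cyc (red eps B) i.+1 *m map_mx eps (psi i.+1))%MS
   = hdim (red eps A) i + hdim (red eps B) i + rk Q i.+1)%N.
Proof.
have [f [f0' fC]] := f_ex.
pose G := cone f.
have cG : is_cplx G := cone_cplx cD cE fC.
have aG : acyclic G.
  apply: cone_acyclic => // u; have [r ->] := rank1_const u D1.
  by rewrite f0' f0E => /in_E/JD.
have in_G (u : 'rV_(rk E 0)) (r : R) (w : 'rV_(prev_rk (rk D) 0)) :
    in_im u -> @in_im R G 0 (row_mx (u + (const_mx r : 'rV_(rk D 0)) *m f0) w).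
  move=> [v ->]; exists (row_mx v (const_mx r)).
  by rewrite mul_row_block f0' mulmx0; congr row_mx; rewrite [w]thinmx0 oppr0 mulmx0 addr0.
have fPhi0 : f0 *m Phi 0%N = 0.
  by rewrite /Phi phi0 psi0 mul_row_col mulmxN !rank1_mul // subrr.
(* [g] and [g'] will be inverse homotopy equivalences between [G] and [Q]. The degree 0 homology of
   [G] is the sum of the two quotients modulo the diagonal; [g] takes the difference of the
   coordinates and [g'] sends 1 to the class of (1, 0). *)
have [g [g0 gC]] : exists g : forall i, 'M[R]_(rk G i, rk Q i),
    g 0%N = col_mx (Phi 0%N) 0 /\ chain g.
  apply: lift_chain => // w.
  rewrite -(hsubmxK w) -mulmxA mul_block_col f0' !mulmx0 !addr0 fPhi0.
  rewrite mul_row_col mulmx0 addr0.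
  set w1 := lsubmx w; rewrite /Phi phi0 psi0 -(hsubmxK w1).
  rewrite mul_block_col !mul0mx addr0 add0r mul_row_col mulmxN mulmxN.
  have [a aE'] := rank1_const (lsubmx w1 *m dif A 0) A1.
  have [b bE'] := rank1_const (rsubmx w1 *m dif B 0) B1.
  rewrite !mulmxA aE' bE' !rank1_mul // !mulr1 -raddfB.
  apply/JQ; exists a, (- b); split=> //; first by exists (lsubmx w1).
  by exists (- rsubmx w1); rewrite mulNmx bE' raddfN.
have [g' [g'0 g'C]] : exists g' : forall i, 'M[R]_(rk Q i, rk G i),
    g' 0%N = row_mx (row_mx (const_mx 1) 0) 0 /\ chain g'.
  apply: lift_chain => // w.
  have [r wE] := rank1_const (w *m dif Q 0) Q1.
  have /JQ[a [b [Aa Bb rE]]] : aug_ideal Q r by exists w.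
  rewrite wE !mul_mx_row rank1_mul // mulr1 !mulmx0.
  (* With r = a + b, (r, 0) is (a, -b) plus b times the diagonal vector (1, 1). *)
  have -> : row_mx (const_mx r) 0 = row_mx (const_mx a) (const_mx (- b)) + (const_mx b :
    'rV_(rk D 0)) *m f0.
    by rewrite f0E add_row_mx; congr row_mx; apply/rowP=> j; rewrite !mxE ?addNr.
  apply: in_G; apply/in_E; split=> //.
  by case: Bb => v vE; exists (- v); rewrite mulNmx -vE raddfN.
pose inc i : 'M[R]_(rk E i, rk G i) := row_mx 1%:M 0.
have incC : chain inc.
  by move=> j; rewrite mul_row_block mul_mx_row !mul1mx !mul0mx !addr0 mulmx1 mulmx0.
have incg : null_htpy (fun j => inc j *m g j - Phi j).
  apply: chain_null => //; first exact: chain_sub (chain_comp incC gC) PhiC.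
  move=> w; rewrite g0 mul_row_col mul1mx mulmx0 addr0 subrr mulmx0; exact: in_im0.
have gg' : null_htpy (fun j => g j *m g' j - 1%:M).
  apply: chain_null => //.
    by apply: chain_sub (chain_comp gC g'C) _ => j; rewrite mul1mx mulmx1.
  move=> w; rewrite mulmxBr mulmx1 g0 g'0 -(hsubmxK w) mulmxA mul_row_col mulmx0 addr0.
  rewrite -(hsubmxK (lsubmx w)) /Phi phi0 psi0 mul_row_col mulmxN.
  have [a ->] := rank1_const (lsubmx (lsubmx w)) A1.
  have [b ->] := rank1_const (rsubmx (lsubmx w)) B1.
  rewrite !rank1_mul // !mulr1 -raddfB !mul_mx_row rank1_mul // mulr1 !mulmx0.
  rewrite opp_row_mx add_row_mx; set w' := (0 - _).
  have -> : row_mx (const_mx (a - b)) 0 - row_mx (const_mx a) (const_mx b)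
     = 0 + (const_mx (- b) : 'rV_(rk D 0)) *m f0 :> 'M[R]_(1, rk A 0 + rk B 0).
    rewrite add0r f0E opp_row_mx add_row_mx; congr row_mx; apply/rowP=> j; rewrite !mxE.
      by rewrite addrAC subrr add0r.
    by rewrite add0r.
  by apply: in_G; exact: in_im0.
have g'g : null_htpy (fun j => g' j *m g j - 1%:M).
  apply: chain_null => //.
    by apply: chain_sub (chain_comp g'C gC) _ => j; rewrite mul1mx mulmx1.
  move=> w; rewrite g0 g'0 mul_row_col mulmx0 addr0 /Phi phi0 psi0 mul_row_col mul0mx addr0.
  have [r ->] := rank1_const w Q1.
  rewrite mulmxBr mulmx1 mulmxA !rank1_mul // !mulr1 subrr; exact: in_im0.
have fPhi : null_htpy (fun j => f j *m Phi j).
  apply: chain_null => //; first exact: chain_comp fC PhiC.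
  by move=> w; rewrite f0' fPhi0 mulmx0; exact: in_im0.
(* [G] is homotopy equivalent to the minimal complex [Q], so its reduced homology in degree j has
   dimension [rk Q j]. *)
have rkQ j : (rk Q j + \rank (dif (red eps G) j))%N = \rank (cyc (red eps G) j).
  rewrite -(@rank_quot _ _ _ _ _ (cyc (red eps G) j) (map_mx eps (g j)) (dif (red eps G) j)).
  - congr (_ + _)%N; apply/esym/eqP/row_fullP.
    have c' : (map_mx eps (g' j) <= cyc (red eps G) j)%MS.
      apply/sub_kermxP; rewrite prev_red; case: j => [|j]; first exact: thinmx0.
      by rewrite /= -map_mxM g'C map_mxM mQ mul0mx.
    have [M ME] := submxP c'; exists M; rewrite mulmxA -ME -map_mxM.
    have e : (map_mx eps (g' j *m g j - 1%:M) <= map_mx eps (dif Q j))%MS.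
      rewrite -[X in (X <= _)%MS]mul1mx; apply: (null_red g'g).
      by rewrite mul1mx prev_red; case: (j) => [|j'] /=; [exact: thinmx0 | rewrite mQ].
    by move: e; rewrite mQ => /submx0null/eqP; rewrite map_mxB map_mx1 subr_eq0 => /eqP ->.
  - by apply/sub_kermxP; exact: (red_cplx eps cG).
  move=> u /sub_kermxP uc; apply/eqP/idP=> [ug|/submxP[v ->]].
    have := null_sub_red gg' uc.
    by rewrite map_mxM mulmxA ug mul0mx sub0r eqmx_opp map_mx1 mulmx1.
  by rewrite -mulmxA /= -map_mxM -gC map_mxM mQ mulmx0 mulmx0.
pose t j := \rank (cyc (red eps D) j *m map_mx eps (f j) + dif (red eps E) j)%MS.
pose w j := \rank (cyc (red eps A) j *m map_mx eps (phi j)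
                   + cyc (red eps B) j *m map_mx eps (psi j))%MS.
have prevE j : prev_dif (dif (red eps E)) j = prev_dif (dif (dsum (red eps A) (red eps B))) j.
  by case: j => [|j] //=; rewrite map_block_mx !map_mx0.
(* Exactness at Tor(A + B). A cycle killed by [Phi] becomes a boundary in the cone, and the blocks
   of that boundary exhibit it as the image of a cycle of [D] plus a boundary. *)
have wt j : (w j + t j = \rank (cyc (red eps E) j))%N.
  have -> : w j = \rank (cyc (red eps E) j *m map_mx eps (Phi j)).
    rewrite /cyc prevE map_col_mx map_mxN; apply/esym.
    apply/eqmx_rank/eqmxP; exact: (cyc_dsum_mul (A := red eps A) (B := red eps B)).
  apply: rank_quot.
    rewrite addsmx_sub; apply/andP; split; apply/sub_kermxP; last exact: (red_cplx eps cE).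
    rewrite -mulmxA prev_red; case: (j) => [|j']; first by apply: thinmx0.
    by rewrite /= -map_mxM fC map_mxM mulmxA mulmx_ker mul0mx.
  move=> u /sub_kermxP uc; apply/eqP/idP=> [uPhi|].
    have uc' : (u *m map_mx eps (inc j)) *m prev_dif (dif (red eps G)) j = 0.
      rewrite prev_red; case: (j) u uc {uPhi} => [|j'] u uc; first by apply: thinmx0.
      by rewrite -mulmxA -map_mxM incC map_mxM mulmxA uc mul0mx.
    have := null_sub_red incg uc; rewrite mQ uPhi subr0 map_mxM mulmxA => /submx0null ug.
    have := null_sub_red gg' uc'; rewrite map_mxM mulmxA ug mul0mx sub0r eqmx_opp.
    rewrite map_mx1 mulmx1 map_row_mx map_mx1 map_mx0 mul_mx_row mulmx1 mulmx0.
    rewrite map_block_mx map_mx0 map_mxN => /submxP[v].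
    rewrite -(hsubmxK v) mul_row_block mulmx0 add0r mulmxN => /eq_row_mx[-> /esym/eqP].
    rewrite oppr_eq0 => /eqP v0; apply: addmx_sub.
      by rewrite (submx_trans _ (addsmxSr _ _)) // submxMl.
    rewrite (submx_trans _ (addsmxSl _ _)) // submxMr //; apply/sub_kermxP.
    by rewrite prev_red.
  have dPhi : dif (red eps E) j *m map_mx eps (Phi j) = 0.
    by rewrite -map_mxM -PhiC map_mxM mQ mulmx0.
  case/sub_addsmxP=> -[u1 u2] ->; rewrite mulmxDl.
  rewrite -[X in X + _]mulmxA -[X in _ + X]mulmxA dPhi mulmx0 addr0.
  rewrite -[X in _ *m X]mulmxA -map_mxM.
  have : (cyc (red eps D) j *m map_mx eps (f j *m Phi j) <= map_mx eps (dif Q j))%MS.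
    by apply: null_red fPhi _; exact: mulmx_ker.
  by rewrite mQ => /submx0null e; have := congr1 (mulmx u1) e; rewrite mulmx0 => e'; exact: e'.
have rG j : \rank (dif (red eps G) j) = (\rank (prev_dif (dif (red eps D)) j) + t j)%N.
  have <- := @rank_cone_dif k (red eps D) (red eps E) (fun j => map_mx eps (f j)) j.
  have -> // : dif (red eps G) j = dif (@cone k (red eps D) (red eps E) (fun j =>
    map_mx eps (f j))) j.
  by rewrite [LHS]map_block_mx map_mx0 map_mxN -(prev_red eps D).
have pE : forall j, \rank (prev_dif (dif (red eps E)) j) = (\rank (prev_dif (dif (red eps
  A)) j) + \rank (prev_dif (dif (red eps B)) j))%N.
  by case=> [|j] /=; rewrite ?mxrank0 // map_block_mx !map_mx0 rank_diag_block_mx.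
(* Only rank counting remains: Tor_i(D) is an extension of the kernel of Tor_i(A + B) -> Tor_i(Q) by
   the cokernel of Tor_(i+1)(A + B) -> Tor_(i+1)(Q). *)
have := hdim_add i (red_cplx eps cA); have := hdim_add i (red_cplx eps cB).
have := hdim_add i (red_cplx eps cD).
have := rank_prev (red eps A) i; have := rank_prev (red eps B) i.
have := rank_prev (red eps E) i; have := pE i.
have := pE i.+1; have := rank_prev (red eps E) i.+1.
have := rank_prev (red eps D) i.
have := rank_prev (red eps G) i.+1.
have := rG i; have := rG i.+1; have := rkQ i.+1; have := wt i; have := wt i.+1.
rewrite -/(w i) -/(w i.+1) /=.
lia.
Qed.

End FiberProduct.

(** * Koszul complexes *)

Fixpoint kos_rk (r : nat -> nat) (m : nat) : nat -> nat :=
  match m with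
  | 0 => r
  | m'.+1 => fun i => (kos_rk r m' i + prev_rk (kos_rk r m') i)%N
  end.

Definition prev_diag (R : pzRingType) (r : nat -> nat) (F : forall i, 'M[R]_(r i)) i :
    'M[R]_(prev_rk r i) :=
  match i return 'M[R]_(prev_rk r i) with 0 => 0 | j.+1 => F j end.

Definition colmul (R : pzRingType) m (c z : 'cV[R]_m) : 'cV[R]_m :=
  \col_i (c i 0 * z i 0).

(** Resolves R itself, so that [kos] applied to it is the usual Koszul complex. *)
Definition triv_cplx (R : pzRingType) : cplx R :=
  @Cplx R (fun i => if i is 0 then 1%N else 0%N) (fun=> 0).

Section Koszul.
Variable R : comNzRingType.
Implicit Types C : cplx R.

(** The tensor product of [C] with the Koszul complex of [z], as an iterated cone of
    multiplications. The first entry of [z] is adjoined last. *)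
Fixpoint kos_dif C (m : nat) :
    'cV[R]_m -> forall i, 'M[R]_(kos_rk (rk C) m i.+1, kos_rk (rk C) m i) :=
  match m with
  | 0 => fun _ => dif C
  | m'.+1 => fun z i =>
      block_mx (kos_dif C (dsubmx (z : 'cV_(1 + m'))) i) 0
        (z 0 0)%:M (- prev_dif (kos_dif C (dsubmx (z : 'cV_(1 + m')))) i)
  end.

Definition kos C m (z : 'cV[R]_m) : cplx R := Cplx (kos_dif C z).

(* [kap c] is the chain map between the Koszul complexes on the sequences
   [c_i z_i] and [z_i] which is the product of the [c_i] over a basis vector. *)
Fixpoint kap (S : pzRingType) (r : nat -> nat) (m : nat) :
    'cV[S]_m -> forall i, 'M[S]_(kos_rk r m i) :=
  match m with
  | 0 => fun _ i => 1%:M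
  | m'.+1 => fun c i =>
      block_mx (kap r (dsubmx (c : 'cV_(1 + m'))) i) 0
        0 (c 0 0 *: prev_diag (kap r (dsubmx (c : 'cV_(1 + m')))) i)
  end.

Lemma kosS C m (z : 'cV[R]_m.+1) :
  kos C z = let K := kos C (dsubmx (z : 'cV_(1 + m))) in
            cone (C := K) (D := K) (fun i => (z 0 0)%:M).
Proof. by []. Qed.

Lemma scalar_chain C (a : R) : @chain R C C (fun i => a%:M).
Proof. by move=> i; rewrite scalar_mxC. Qed.

Lemma kos_cplx C m (z : 'cV_m) : is_cplx C -> is_cplx (kos C z).
Proof.
move=> cC; elim: m z => [|m IH] z //; rewrite kosS.
by apply: cone_cplx => //; exact: scalar_chain.
Qed.

Lemma kos_rk0 C m (z : 'cV_m) : rk C 0 = 1%N -> rk (kos C z) 0 = 1%N.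
Proof.
by move=> C1; elim: m z => [|m IH] z //; rewrite kosS /= addn0;
  exact: IH (dsubmx (z : 'cV_(1 + m))).
Qed.

Definition adjoin (J : R -> Prop) m (z : 'cV[R]_m) (r : R) :=
  exists a (w : 'rV_m), J a /\ r = a + (w *m z) 0 0.

Lemma rV_cV_S m (w : 'rV[R]_m.+1) (z : 'cV_m.+1) :
  (w *m z) 0 0 = w 0 0 * z 0 0
    + (rsubmx (w : 'rV_(1 + m)) *m dsubmx (z : 'cV_(1 + m))) 0 0.
Proof.
rewrite -{1}[w](@hsubmxK _ 1 1 m) -{1}[z](@vsubmxK _ 1 m 1) (@mul_row_col _ 1 1 m 1).
by rewrite mxE [X in X + _]mxE big_ord1 !mxE lshift0.
Qed.

Lemma adjoinS (J : R -> Prop) m (z : 'cV[R]_m.+1) r :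
  adjoin J z r <->
  exists a b, adjoin J (dsubmx (z : 'cV_(1 + m))) a /\ r = a + b * z 0 0.
Proof.
split=> [[a [w [Ja ->]]]|[a [b [[a' [w [Ja ->]]] ->]]]].
  exists (a + (rsubmx (w : 'rV_(1 + m)) *m dsubmx (z : 'cV_(1 + m))) 0 0), (w 0 0).
  split; first by exists a, (rsubmx (w : 'rV_(1 + m))).
  by rewrite rV_cV_S -addrA [X in _ + X]addrC.
exists a', (row_mx b%:M w : 'rV_(1 + m)); split=> //.
rewrite rV_cV_S row_mxKr -addrA [X in _ + X]addrC; congr (_ + (_ * _ + _)).
by rewrite mxE; case: splitP => // j _; rewrite !ord1 mxE eqxx.
Qed.

Lemma aug_cone_scalar C (z r : R) : rk C 0 = 1%N ->
  aug_ideal (@cone R C C (fun i => z%:M)) r <->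
  exists a b, aug_ideal C a /\ r = a + b * z.
Proof.
move=> C1; split.
  case=> w; rewrite -(hsubmxK w) mul_row_block mul_mx_scalar /=.
  rewrite -[const_mx r](@hsubmxK _ _ (rk C 0) 0) => /eq_row_mx[e _].
  have [b bE] := rank1_const (rsubmx w : 'rV_(rk C 0)) C1.
  have [a aE] := rank1_const (lsubmx w *m dif C 0) C1.
  exists a, b; split; first by exists (lsubmx w).
  move: e; rewrite aE bE => /matrixP/(_ 0 (cast_ord (esym C1) ord0)).
  by rewrite !mxE mulrC.
move=> [a [b [[w wE] ->]]].
exists (row_mx w (const_mx b)); rewrite mul_row_block -wE mul_mx_scalar /=.
rewrite -[LHS](@hsubmxK _ _ (rk C 0) 0); congr row_mx;
  last by rewrite [LHS]thinmx0 [RHS]thinmx0.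
by apply/matrixP=> i j; rewrite !mxE mulrC.
Qed.

Lemma aug_kos C m (z : 'cV_m) r : rk C 0 = 1%N ->
  aug_ideal (kos C z) r <-> adjoin (aug_ideal C) z r.
Proof.
move=> C1; elim: m z r => [|m IH] z r.
  split=> [Jr|[a [w [Ja ->]]]].
    by exists r, 0; split=> //; rewrite mul0mx mxE addr0.
  by rewrite [w]thinmx0 mul0mx mxE addr0.
rewrite kosS adjoinS; split.
  move/aug_cone_scalar; case; first exact: kos_rk0.
  by move=> a [b [/IH Ja ->]]; exists a, b.
move=> [a [b [/IH Ja ->]]]; apply/aug_cone_scalar; first exact: kos_rk0.
by exists a, b.
Qed.

(** The order follows [kos_dif]: each entry is a nonzerodivisor modulo [J] and the entries after
    it. *)
Fixpoint regular (J : R -> Prop) m : 'cV[R]_m -> Prop :=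
  match m with
  | 0 => fun _ => True
  | m'.+1 => fun z =>
     (forall a, adjoin J (dsubmx (z : 'cV_(1 + m'))) (a * z 0 0) ->
                adjoin J (dsubmx (z : 'cV_(1 + m'))) a)
     /\ regular J (dsubmx (z : 'cV_(1 + m')))
  end.

Lemma kos_acyclic C m (z : 'cV_m) : rk C 0 = 1%N -> acyclic C ->
  regular (aug_ideal C) z -> acyclic (kos C z).
Proof.
move=> C1 aC; elim: m z => [|m IH] z // [z0 rz]; rewrite kosS.
apply: cone_acyclic; [exact: IH|exact: IH|exact: scalar_chain|].
move=> u; set K := kos _ _; have K1 : rk K 0 = 1%N by exact: kos_rk0.
have [r ->] := rank1_const u K1.
have -> : const_mx r *m (z 0 0)%:M = const_mx (r * z 0 0) :> 'rV_(rk K 0).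
  by rewrite mul_mx_scalar; apply/matrixP=> i j; rewrite !mxE mulrC.
by move/(aug_kos _ _ C1)/z0/(aug_kos _ _ C1).
Qed.

Lemma triv_is_cplx : is_cplx (triv_cplx R).
Proof. by move=> i; rewrite mul0mx. Qed.

Lemma triv_acyclic : acyclic (triv_cplx R).
Proof. by move=> i u _; exists 0; rewrite [u]thinmx0 [RHS]thinmx0. Qed.

Lemma aug_triv r : aug_ideal (triv_cplx R) r <-> r = 0.
Proof.
split=> [[w /matrixP/(_ 0 0)]|->]; first by rewrite mulmx0 !mxE.
by exists 0; apply/matrixP=> i j; rewrite mulmx0 !mxE.
Qed.

Lemma prev_diag_dif (r : nat -> nat) (F : forall i, 'M[R]_(r i))
    (D D' : forall i, 'M[R]_(r i.+1, r i)) i :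
  (forall i, F i.+1 *m D i = D' i *m F i) ->
  F i *m prev_dif D i = prev_dif D' i *m prev_diag F i.
Proof. by move=> H; case: i => [|i] //=; rewrite [LHS]thinmx0 [RHS]thinmx0. Qed.

Lemma dsub_colmul (S : pzRingType) m (c z : 'cV[S]_m.+1) :
  dsubmx (colmul c z : 'cV_(1 + m)) =
  colmul (dsubmx (c : 'cV_(1 + m))) (dsubmx (z : 'cV_(1 + m))).
Proof. by apply/colP=> a; rewrite !mxE. Qed.

Lemma kap_chain C m (c z : 'cV[R]_m) :
  @chain R (kos C (colmul c z)) (kos C z) (kap (rk C) c).
Proof.
rewrite /chain /=; elim: m c z => [|m IH] c z i; first by rewrite /= mul1mx mulmx1.
rewrite /= dsub_colmul !mulmx_block !mulmx0 !mul0mx !addr0 !add0r IH; congr block_mx.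
  by rewrite mxE mul_mx_scalar mul_scalar_mx scalerA mulrC.
rewrite mulmxN mulNmx -scalemxAr -scalemxAl; congr (- (_ *: _)).
exact: prev_diag_dif.
Qed.

Lemma kap0 C m (c : 'cV[R]_m) : rk C 0 = 1%N ->
  kap (rk C) c 0 = const_mx 1 :> 'M_(rk (kos C c) 0).
Proof.
move=> C1; rewrite const1_id; last exact: kos_rk0.
elim: m c => [|m IH] c //=;
  rewrite IH [X in block_mx _ _ _ X](_ : _ = 1%:M) -?scalar_mx_block //.
by rewrite [LHS]thinmx0 [RHS]thinmx0.
Qed.

End Koszul.

(** * Coordinate projections of the exterior algebra *)

Section KoszulDiagonal.
Variables (k : fieldType) (r : nat -> nat).

Lemma kap_mul m (c c' : 'cV[k]_m) i : kap r c i *m kap r c' i = kap r (colmul c c') i.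
Proof.
elim: m c c' i => [|m IH] c c' i; first by rewrite /= mul1mx.
rewrite /= dsub_colmul mulmx_block !mulmx0 !mul0mx !addr0 !add0r IH mxE.
rewrite -scalemxAr -scalemxAl scalerA mulrC; congr block_mx; congr (_ *: _).
by case: i => [|i]; [exact: mulmx0 | exact: IH].
Qed.

End KoszulDiagonal.

Definition bitcol (R : pzRingType) m (s : pred 'I_m) : 'cV[R]_m := \col_i (s i)%:R.

Lemma colmul_bitcol (R : pzRingType) m (s t : pred 'I_m) :
  colmul (bitcol R s) (bitcol R t) = bitcol R (predI s t).
Proof. by apply/colP=> i; rewrite !mxE /= mulr_natl mulrb; case: (s i). Qed.

(** The matrix is diagonal, with entry 1 at the basis vectors indexed by subsets of [s] and 0
    elsewhere; Pascal's rule counts these subsets. *)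
Lemma rank_kap_triv (k : fieldType) m (s : pred 'I_m) i :
  \rank (kap (rk (triv_cplx k)) (bitcol k s) i) = 'C(\sum_j s j, i).
Proof.
elim: m s i => [|m IH] s i.
  by rewrite big_ord0 /= mxrank1; case: i.
have dsub_bit : dsubmx (bitcol k s : 'cV_(1 + m)) = bitcol k (fun j => s (rshift 1 j)).
  by apply/colP=> j; rewrite !mxE.
rewrite /= dsub_bit rank_diag_block_mx IH big_ord_recl.
have <- : (\sum_j s (rshift 1 j) = \sum_(j < m) s (lift ord0 j))%N.
  by apply: eq_bigr => j _; congr (nat_of_bool (s _)); apply: val_inj.
set N := (\sum_j _)%N; rewrite mxE.
case: (s _); last by rewrite scale0r mxrank0 addn0 add0n.
rewrite scale1r; case: i => [|i] /=; last by rewrite IH add1n binS.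
by rewrite mxrank0 !bin0.
Qed.

Lemma kos_rk_triv (R : pzRingType) m i : kos_rk (rk (triv_cplx R)) m i = 'C(m, i).
Proof.
elim: m i => [|m IH] i; first by case: i.
by case: i => [|i] /=; rewrite !IH ?bin0 // binS.
Qed.

(** These matrices are commuting idempotents whose product belongs to the intersection of the index
    sets. Hence their row spaces meet in the row space of the product. *)
Lemma rank_kap_sum (k : fieldType) m (s t : pred 'I_m) i :
  (\rank (kap (rk (triv_cplx k)) (bitcol k s) i + kap (rk (triv_cplx k)) (bitcol k t) i)%MS
   + 'C(\sum_j (s j && t j), i) = 'C(\sum_j s j, i) + 'C(\sum_j t j, i))%N.
Proof.
rewrite -!(rank_kap_triv k) -[RHS]mxrank_sum_cap; congr (_ + _)%N.
set K := fun x : pred 'I_m => kap (rk (triv_cplx k)) (bitcol k x) i.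
have KM x y : K x *m K y = K (predI x y) by rewrite /K kap_mul colmul_bitcol.
have KC x y : K (predI x y) = K (predI y x).
  by congr (kap _ _ i); apply/colP=> l; rewrite !mxE /= andbC.
have Kx x : K (predI x x) = K x.
  by congr (kap _ _ i); apply/colP=> l; rewrite !mxE /= andbb.
rewrite -/(K s) -/(K t) -/(K (predI s t)); apply/eqmx_rank/andP; split.
  by rewrite sub_capmx {1}KC -!KM !submxMl.
apply/row_subP=> j; have := row_sub j (K s :&: K t)%MS.
set u := row j _; rewrite sub_capmx => /andP[/submxP[v vE] /submxP[w wE]].
have -> : u = u *m K (predI s t).
  have us : u *m K s = u by rewrite [in LHS]vE -mulmxA KM Kx.
  have ut : u *m K t = u by rewrite [in LHS]wE -mulmxA KM Kx.
  by rewrite -KM mulmxA us ut.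
exact: submxMl.
Qed.

Lemma kap_bit1 (R : pzRingType) r m i : kap r (bitcol R (m := m) predT) i = 1%:M.
Proof.
elim: m i => [|m IH] i //=.
have -> : dsubmx (bitcol R predT : 'cV_(1 + m)) = bitcol R predT.
  by apply/colP=> j; rewrite !mxE.
rewrite IH mxE scale1r scalar_mx_block; congr block_mx.
by case: i => [|i] /=; [rewrite [RHS]thinmx0 | rewrite IH].
Qed.

Section KoszulReduction.
Variables (R : comNzRingType) (k : fieldType) (eps : {rmorphism R -> k}).

Lemma map_kap r m (c : 'cV[R]_m) i : map_mx eps (kap r c i) = kap r (map_mx eps c) i.
Proof.
elim: m c i => [|m IH] c i; first by rewrite /= map_mx1.
rewrite /= map_block_mx !map_mx0 map_mxZ IH -map_dsubmx mxE; congr (block_mx _ _ _ (_ *: _)).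
by case: i => [|i]; [exact: map_mx0 | exact: IH].
Qed.

Lemma minimal_kos m (z : 'cV[R]_m) : (forall j, eps (z j 0) = 0) ->
  minimal eps (kos (triv_cplx R) z).
Proof.
rewrite /minimal /=; elim: m z => [|m IH] z ez i; first by rewrite /= map_mx0.
have IH' := IH (dsubmx (z : 'cV_(1 + m))); rewrite /= map_block_mx map_mx0 IH'; last first.
  by move=> j; rewrite mxE.
rewrite map_scalar_mx /= ez raddf0 map_mxN.
have -> : map_mx eps (prev_dif (kos_dif (triv_cplx R) (dsubmx (z : 'cV_(1 + m)))) i) = 0.
  case: i => [|i]; first exact: map_mx0.
  by apply: IH' => j; rewrite mxE.
by rewrite oppr0 block_mx0.
Qed.

(** Since [a] reduces to 0, the reduced cone is, up to sign, the sum of the reduced complex and its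
    shift. This is the source of each factor 1 + t. *)
Lemma hdim_cone_scalar (C : cplx R) (a : R) i : is_cplx C -> eps a = 0 ->
  hdim (red eps (@cone R C C (fun i => a%:M))) i =
  (hdim (red eps C) i + prev_rk (hdim (red eps C)) i)%N.
Proof.
move=> cC ea; set G := cone _.
have cG : is_cplx G by apply: cone_cplx => //; exact: scalar_chain.
have rG j : \rank (dif (red eps G) j) =
    (\rank (dif (red eps C) j) + \rank (prev_dif (dif (red eps C)) j))%N.
  rewrite /= map_block_mx map_mx0 map_scalar_mx ea raddf0 rank_diag_block_mx map_mxN.
  by rewrite eqmx_opp -(prev_red eps C j).
have := rG i; have := rank_prev (red eps G) i; have := rank_prev (red eps C) i.
have := hdim_add i (red_cplx eps cG); have := hdim_add i (red_cplx eps cC).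
case: i => [|i]; first by rewrite /= !mxrank0; lia.
have := rG i; have := rank_prev (red eps C) i.
have := hdim_add i (red_cplx eps cC) => /=; lia.
Qed.

(** * The image of Tor(S, k) in Tor(k, k) *)

Section Image.
Variables (A : cplx R) (m : nat) (z : 'cV[R]_m) (s : pred 'I_m).
Let Q := kos (triv_cplx R) z.
Let J0 (r : R) := r = 0.
(** Multiplying [z] by this column squares its entry j. Modulo the maximal ideal the column becomes
    the indicator of the indices other than j, so that [kap] reduces to a projection. *)
Definition sq_col j : 'cV[R]_m := \col_i (if i == j then z j 0 else 1).
Hypotheses (cA : is_cplx A) (aA : acyclic A) (A1 : rk A 0 = 1%N).
Hypotheses (ez : forall j, eps (z j 0) = 0) (rz : regular J0 z).
Hypothesis inA : forall j, s j -> aug_ideal A (z j 0).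
Hypothesis Asq : forall j, ~~ s j -> forall r, aug_ideal A r ->
  adjoin J0 (colmul (sq_col j) z) r.
Hypothesis rsq : forall j, ~~ s j -> regular J0 (colmul (sq_col j) z).

Lemma triv_kos_acyclic l (y : 'cV[R]_l) : regular J0 y -> acyclic (kos (triv_cplx R) y).
Proof.
move=> ry; apply: kos_acyclic => //; first exact: triv_acyclic.
suff -> : aug_ideal (triv_cplx R) = J0 by [].
by apply: functional_extensionality_dep => r; apply: propext; exact: aug_triv.
Qed.

Lemma aug_triv_kos l (y : 'cV[R]_l) r :
  aug_ideal (kos (triv_cplx R) y) r <-> adjoin J0 y r.
Proof.
split=> [/aug_kos[]// a [w [/aug_triv a0 ->]]|[a [w [a0 ->]]]]; first by exists a, w.
by apply/aug_kos => //; exists a, w; split=> //; apply/aug_triv.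
Qed.

Lemma image_kap (phi : forall i, 'M[R]_(rk A i, rk Q i)) i :
  chain phi -> phi 0%N = const_mx 1 ->
  (cyc (red eps A) i *m map_mx eps (phi i) :=: kap (rk (triv_cplx k)) (bitcol k s) i)%MS.
Proof.
move=> phiC phi0.
have cQ l (y : 'cV[R]_l) : is_cplx (kos (triv_cplx R) y).
  by apply: kos_cplx; exact: triv_is_cplx.
have aQ : acyclic Q by exact: triv_kos_acyclic.
have Q1 l (y : 'cV[R]_l) : rk (kos (triv_cplx R) y) 0 = 1%N by exact: kos_rk0.
have mQ : minimal eps Q by exact: minimal_kos.
have cyc1 l (y : 'cV[R]_l) j (M : 'M_(_, _)) : (forall j, eps (y j 0) = 0) ->
    M *m prev_dif (dif (red eps (kos (triv_cplx R) y))) j = 0.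
  move=> ey; rewrite prev_red; case: j M => [|j] M; first exact: thinmx0.
  by rewrite /= (minimal_kos ey) mulmx0.
pose K (x : pred 'I_m) := kap (rk (triv_cplx k)) (bitcol k x) i.
set M := _ *m _.
have ecol c : (forall j, eps (colmul c z j 0) = 0).
  by move=> j; rewrite mxE rmorphM ez mulr0.
apply/eqmxP/andP; split.
  (* Up to homotopy [phi] is [eta] followed by [kap]; [Q] being minimal, the two agree on reduced
     cycles. So the image is fixed by the projection that kills the basis vectors involving j. *)
  have step j : ~~ s j -> M = M *m K (fun l => l != j).
    move=> sj; pose c := sq_col j; pose Q' := kos (triv_cplx R) (colmul c z).
    have aQ' : acyclic Q' by apply: triv_kos_acyclic; exact: rsq.
    have [eta [eta0 etaC]] : exists eta : forall i, 'M_(rk A i, rk Q' i),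
        eta 0%N = const_mx 1 /\ chain eta.
      by apply: lift_one => // r /(Asq sj) Jr; apply/aug_triv_kos.
    pose kc := kap (rk (triv_cplx R)) c.
    have : null_htpy (fun i => phi i - eta i *m kc i).
      apply: chain_null => //.
        by apply: chain_sub => //; apply: chain_comp => //; exact: kap_chain.
      have -> : eta 0%N *m kc 0%N = phi 0%N.
        rewrite eta0 phi0 [kc _](@kap0 R (triv_cplx R)) //.
        by rewrite [LHS]rank1_mul ?mulr1 //; exact: Q1 (colmul c z).
      by move=> w; rewrite subrr mulmx0; exact: in_im0.
    move=> nl; have := @null_sub_red _ _ eps A Q _ _ i _ (cyc (red eps A) i) nl (mulmx_ker _).
    rewrite mQ => /submx0null/eqP; rewrite subr_eq0 => /eqP e.
    have ME : M = cyc (red eps A) i *m map_mx eps (eta i) *m K (fun l => l != j).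
      rewrite /M e map_mxM map_kap mulmxA; congr (_ *m kap _ _ _).
      by apply/colP=> l; rewrite !mxE; case: eqP => _; rewrite ?ez ?rmorph1.
    have KK : K (fun l => l != j) *m K (fun l => l != j) = K (fun l => l != j).
      rewrite /K kap_mul; apply: (congr1 (fun x => kap _ x i)); apply/colP=> l.
      by rewrite !mxE; case: eqP; rewrite ?mulr0 ?mulr1.
    by rewrite ME -[RHS]mulmxA KK.
  (* These projections multiply, so all indices outside [s] can be removed together. *)
  have {}step (l : seq 'I_m) : M = M *m K (fun j => s j || (j \notin l)).
    elim: l => [|j l IH].
      have -> : K (fun j => s j || (j \notin [::])) = 1%:M; last by rewrite mulmx1.
      rewrite -[RHS](kap_bit1 k (rk (triv_cplx k))); apply: (congr1 (fun x => kap _ x i));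
        apply/colP => j.
      by rewrite !mxE /= orbT.
    case sj : (s j).
      rewrite {1}IH; apply: (congr1 (fun x => _ *m kap _ x i)); apply/colP=> l';
        rewrite !mxE inE.
      by case: eqP => [->|_] //; rewrite sj.
    rewrite {1}(step j) ?sj // {1}IH -mulmxA kap_mul; apply: (congr1 (fun x => _ *m kap _ x i)).
    apply/colP=> l'; rewrite !mxE inE negb_or; case: eqP => [->|_]; last by rewrite mulr1.
    by rewrite sj mulr0.
  rewrite (step (enum 'I_m)) (_ : K _ = K s) ?submxMl //; apply: (congr1 (fun x => kap _ x i)).
  by apply/colP=> j; rewrite !mxE mem_enum orbF.
(* For the other inclusion the entries of [z] outside [s] are replaced by 0 rather than dropped,
   which keeps the index set. [Q'] is only the source of a lift, hence may fail to be acyclic; it is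
   minimal, so every reduced vector is a cycle. *)
pose c := bitcol R s; pose Q' := kos (triv_cplx R) (colmul c z).
have [theta [theta0 thetaC]] : exists theta : forall i, 'M_(rk Q' i, rk A i),
    theta 0%N = const_mx 1 /\ chain theta.
  apply: lift_one; [exact: cQ | exact: aA | exact: (Q1 _ (colmul c z)) |].
  move=> r /aug_triv_kos[_ [w [-> ->]]]; rewrite add0r mxE.
  rewrite /aug_ideal; elim/big_ind: _ => [|x y|j _].
  - by rewrite raddf0; exact: in_im0.
  - by rewrite raddfD; exact: in_imD.
  rewrite mxE mulrA mxE; case sj: (s j); last by rewrite mulr0 mul0r raddf0; exact: in_im0.
  have [v vE] := inA sj; exists ((w 0 j * 1) *: v); rewrite -scalemxAl -vE.
  by apply/matrixP=> a b; rewrite !mxE.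
have : @null_htpy R Q' Q (fun i => theta i *m phi i - kap (rk (triv_cplx R)) c i).
  apply: chain_null; [exact: cQ | exact: aQ | |].
    by apply: (@chain_sub R Q' Q); [exact: (@chain_comp _ Q' A Q) | exact: kap_chain].
  have -> : theta 0%N *m phi 0%N = kap (rk (triv_cplx R)) c 0.
    by rewrite theta0 phi0 [RHS](@kap0 R (triv_cplx R)) // [LHS]rank1_mul ?mulr1.
  by move=> w; rewrite subrr mulmx0; exact: in_im0.
move=> nl.
have := @null_sub_red _ _ eps Q' Q _ _ i _ 1%:M nl (cyc1 _ _ _ _ _ (ecol c)).
rewrite mQ => /submx0null/eqP; rewrite subr_eq0 !mul1mx map_kap map_mxM => /eqP e.
rewrite -/(K s) (_ : K s = map_mx eps (theta i) *m map_mx eps (phi i)).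
  apply: submxMr; apply/sub_kermxP; rewrite prev_red.
  case: (i) => [|j]; first exact: thinmx0.
  by rewrite /= -map_mxM thetaC map_mxM (minimal_kos (ecol c)) mul0mx.
rewrite e; apply: (congr1 (fun x => kap _ x i)); apply/colP=> j; rewrite !mxE;
  by case: (s j); rewrite ?rmorph1 ?rmorph0.
Qed.

End Image.
End KoszulReduction.

(** * Regular sequences and first Koszul homology *)

Section Regular.
Variables (R : comNzRingType) (k : fieldType) (eps : {rmorphism R -> k}).
(** [geo] and [sep] are the completeness and separatedness of the ring along one element of the
    maximal ideal, in the form used by Nakayama-type arguments. *)
Hypothesis geo : forall z, eps z = 0 -> forall s : nat -> R,
  exists T : nat -> R, forall n, T n = s n + z * T n.+1.
Hypothesis sep : forall z, eps z = 0 -> forall b : nat -> R,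
  (forall n, b n = z * b n.+1) -> b 0%N = 0.
Hypothesis eps_onto : forall c, exists u, eps u = c.

Let J0 (r : R) := r = 0.

(* The first Koszul homology vanishes; unlike regularity, this is visibly
   invariant under GL_m. The matrices U - U^T are the alternating ones. *)
Definition trivial_syz m (z : 'cV[R]_m) :=
  forall a : 'rV_m, a *m z = 0 -> exists U : 'M_m, a = z^T *m (U - U^T).

Lemma cV1_eq0 (M : 'M[R]_1) : (M 0 0 = 0) <-> M = 0.
Proof.
by split=> [M0|->]; [apply/matrixP=> i j; rewrite !ord1 M0 mxE | rewrite mxE].
Qed.

Lemma adjoin0 m (z : 'cV[R]_m) r : adjoin J0 z r <-> exists w : 'rV_m, r = (w *m z) 0 0.
Proof.
split=> [[a [w [-> ->]]]|[w ->]]; first by exists w; rewrite add0r.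
by exists 0, w; rewrite add0r.
Qed.

Lemma cV_split m (z : 'cV[R]_m.+1) :
  z = col_mx (z 0 0)%:M (dsubmx (z : 'cV_(1 + m))) :> 'cV_(1 + m).
Proof.
rewrite -{1}[z](@vsubmxK _ 1 m 1); congr col_mx.
by apply/matrixP=> i j; rewrite !ord1 !mxE lshift0 eqxx.
Qed.

Lemma rV_split m (z : 'rV[R]_m.+1) :
  z = row_mx (z 0 0)%:M (rsubmx (z : 'rV_(1 + m))) :> 'rV_(1 + m).
Proof.
rewrite -{1}[z](@hsubmxK _ 1 1 m); congr row_mx.
by apply/matrixP=> i j; rewrite !ord1 !mxE lshift0 eqxx.
Qed.

(** By regularity the first coordinate of a syzygy lies in the ideal of the tail. Koszul relations
    involving the first entry then make that coordinate 0 and leave a syzygy of the tail. *)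
Lemma regular_syz m (z : 'cV[R]_m) : regular J0 z -> trivial_syz z.
Proof.
elim: m z => [|m IH] z; first by move=> _ a _; exists 0; rewrite [LHS]thinmx0 [RHS]thinmx0.
set zs := dsubmx (z : 'cV_(1 + m)) => -[z0 rz] a az.
have [w wE] : exists w : 'rV_m, a 0 0 = (w *m zs) 0 0.
  apply/adjoin0/z0/adjoin0; exists (- rsubmx (a : 'rV_(1 + m))).
  by apply/eqP; rewrite mulNmx [X in _ == X]mxE -addr_eq0 -rV_cV_S az mxE.
have wM : w *m zs = (a 0 0)%:M by apply/matrixP=> i j; rewrite !ord1 -wE mxE eqxx.
have [U UE] : exists U : 'M_m, rsubmx (a : 'rV_(1 + m)) + z 0 0 *: w = zs^T *m (U - U^T).
  apply: (IH _ rz); apply/cV1_eq0; move/cV1_eq0: az; rewrite rV_cV_S wE -/zs.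
  by rewrite mulmxDl -scalemxAl [in X in _ -> X]mxE [in X in _ -> _ + X = _]mxE addrC mulrC.
exists (block_mx 0 0 w^T U : 'M_(1 + m)).
rewrite [in LHS](rV_split a) [in RHS](cV_split z) -/zs (@tr_block_mx _ 1 m 1 m) (@tr_col_mx
  _ 1 m 1).
rewrite !trmx0 trmxK (@opp_block_mx _ 1 m 1 m) (@add_block_mx _ 1 m 1 m) (@mul_row_block _
  1 1 m 1 m).
rewrite !subr0 tr_scalar_mx !mulmx0 !add0r -UE mul_scalar_mx scalerN;
  apply: (congr2 (@row_mx _ 1 1 m)).
  by rewrite -trmx_mul wM tr_scalar_mx.
by rewrite addrC addrK.
Qed.

(** The diagonal of [U - U^T] is zero, in characteristic 2 too, so the first coordinate of a trivial
    syzygy lies in the ideal of the tail. *)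
Lemma alt_sum m (z : 'cV[R]_m.+1) (U : 'M_m.+1) (V := U - U^T) :
  (z^T *m V) 0 0 = ((\row_j V (rshift 1 j) 0) *m dsubmx (z : 'cV_(1 + m))) 0 0.
Proof.
rewrite mxE big_ord_recl [X in X + _](_ : _ = 0) ?add0r; last by rewrite !mxE subrr mulr0.
rewrite [RHS]mxE; apply: eq_bigr => j _; rewrite -rshift1.
by rewrite [in LHS]mxE [X in _ = X * _]mxE [X in _ = _ * X]mxE mulrC.
Qed.

(** For the head, a relation a z_0 = w zs is a syzygy (a, -w), and [alt_sum] applies. For the tail,
    vanishing of H_1 for [z] makes z_0 surjective on H_1 of the tail, which must then vanish by
    completeness. *)
Lemma syz_regular m (z : 'cV[R]_m) :
  (forall j, eps (z j 0) = 0) -> trivial_syz z -> regular J0 z.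
Proof.
elim: m z => [|m IH] z ez sz //.
set zs := dsubmx (z : 'cV_(1 + m)).
split.
  rewrite -/zs => a /adjoin0[w wE]; apply/adjoin0.
  have [|U] := sz (row_mx a%:M (- w) : 'rV_(1 + m)).
    rewrite (cV_split z) -/zs (@mul_row_col _ 1 1 m 1) -scalar_mxM wE mulNmx.
    by apply/matrixP=> i j; rewrite !ord1 !mxE eqxx mulr1n subrr.
  move/matrixP/(_ 0 0); rewrite alt_sum => e.
  exists (\row_j (U - U^T) (rshift 1 j) 0); rewrite -e.
  rewrite mxE; case: splitP => // j _; by rewrite !ord1 mxE eqxx.
apply: IH => [j|]; first by rewrite mxE.
rewrite -/zs => a az.
(* (0, w) is a trivial syzygy of [z]. The block of its alternating matrix on the tail gives a
   trivial syzygy of the tail, the first row gives the multiple of z_0, and the coordinate 0 says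
   that this row is again a syzygy. *)
have step (w : 'rV_m) : w *m zs = 0 -> exists UW : 'M_m * 'rV_m,
   w = zs^T *m (UW.1 - UW.1^T) + z 0 0 *: UW.2 /\ UW.2 *m zs = 0.
  move=> wz; have [|U UE] := sz (row_mx 0 w : 'rV_(1 + m)).
    by rewrite (cV_split z) -/zs (@mul_row_col _ 1 1 m 1) mul0mx wz addr0.
  pose V := U - U^T.
  have Vn i j : V i j = - V j i by rewrite !mxE opprB.
  exists (drsubmx (U : 'M_(1 + m)), - \row_j V (rshift 1 j) 0) => /=; split.
    apply/rowP=> j; have := congr1 (fun M : 'rV_(1 + m) => M 0 (rshift 1 j)) UE.
    rewrite row_mxEr => ->; rewrite mxE big_ord_recl -/V.
    rewrite [in RHS]mxE addrC; congr (_ + _).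
      by rewrite (Vn ord0) !mxE.
    by rewrite [in RHS]mxE; apply: eq_bigr => l _; rewrite -rshift1 !mxE.
  apply/cV1_eq0; rewrite mulNmx mxE -alt_sum -UE.
  rewrite mxE; case: splitP => // j _; by rewrite mxE oppr0.
(* Nakayama: modulo alternating syzygies, every syzygy of the tail is a multiple
   of [z 0 0], and this can be iterated and summed up. *)
have [w [w0 wS]] : exists w : nat -> 'rV[R]_m, w 0%N = a /\ forall n,
    exists U : 'M_m, w n = zs^T *m (U - U^T) + z 0 0 *: w n.+1.
  apply: (@dep_choice (fun=> 'rV[R]_m) (fun _ w => w *m zs = 0)
    (fun _ w w' => exists U : 'M_m, w = zs^T *m (U - U^T) + z 0 0 *: w')) => //.
  by move=> _ x /step[[U w] [/= e1 e2]]; exists w; split=> //; exists U.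
have [U UE] := choice wS.
have /fin_all_exists[T' TE] : forall ij : 'I_m * 'I_m, exists T : nat -> R,
    forall n, T n = U n ij.1 ij.2 + z 0 0 * T n.+1.
  by move=> ij; exact: (geo (ez 0) (fun n => U n ij.1 ij.2)).
pose W n : 'M[R]_m := \matrix_(i, j) T' (i, j) n.
have WE n : W n = U n + z 0 0 *: W n.+1.
  by apply/matrixP=> i j; rewrite !mxE TE.
pose b n := w n - zs^T *m (W n - (W n)^T).
have bE n : b n = z 0 0 *: b n.+1.
  have WW : W n - (W n)^T = (U n - (U n)^T) + z 0 0 *: (W n.+1 - (W n.+1)^T).
    by rewrite {1 2}WE linearD linearZ /= opprD addrACA -scalerBr.
  by rewrite /b [in LHS]UE WW (mulmxDr _ (U n - _)) -scalemxAr opprD addrACA subrr add0r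
    scalerBr.
exists (W 0%N); rewrite -w0; apply/eqP; rewrite -subr_eq0; apply/eqP/rowP=> j.
rewrite [RHS]mxE; apply: (sep (ez 0) (b := fun n => b n 0 j)) => n.
by rewrite [in LHS]bE mxE.
Qed.

Lemma syz_GL m (z : 'cV[R]_m) (A B : 'M_m) :
  A *m B = 1%:M -> trivial_syz z -> trivial_syz (A *m z).
Proof.
move=> AB sz a az; have BA := mulmx1C AB.
have [|U UE] := sz (a *m A); first by rewrite -mulmxA.
exists (B^T *m U *m B); rewrite trmx_mul.
have -> : B^T *m U *m B - (B^T *m U *m B)^T = B^T *m (U - U^T) *m B.
  by rewrite !trmx_mul trmxK mulmxBr mulmxBl !mulmxA.
rewrite !mulmxA -(mulmxA _ A^T) -trmx_mul BA trmx1 mulmx1 -UE.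
by rewrite -mulmxA AB mulmx1.
Qed.

(** Squaring the head of a regular sequence is harmless, as a nonzerodivisor has a nonzerodivisor
    square. A transposition moves entry j to the head; before and after, regularity is carried
    across it by [trivial_syz]. *)
Lemma regular_sq m (z : 'cV[R]_m) j :
  (forall j, eps (z j 0) = 0) -> trivial_syz z -> regular J0 (colmul (sq_col z j) z).
Proof.
case: m z j => [|m] z j ez sz; first by case: j.
pose t := tperm 0 j.
have PP : perm_mx t *m perm_mx t = 1%:M :> 'M[R]_m.+1.
  by rewrite -perm_mxM tperm2 perm_mx1.
have r1 : regular J0 (perm_mx t *m z).
  apply: syz_regular; last exact: syz_GL PP sz.
  by move=> i; rewrite -row_permE mxE ez.
set z2 := colmul _ _.
suff : regular J0 (perm_mx t *m z2).
  move/regular_syz/(syz_GL PP); rewrite mulmxA PP mul1mx; apply: syz_regular.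
  by move=> i; rewrite mxE rmorphM ez mulr0.
have z2s : dsubmx (perm_mx t *m z2 : 'cV_(1 + m)) = dsubmx (perm_mx t *m z : 'cV_(1 + m)).
  apply/colP=> i; rewrite -!row_permE !mxE; case: eqP => [|_]; last by rewrite mul1r.
  move=> e; have := tpermR 0 j; rewrite -/t -{1}e tpermK => /(congr1 val) /=.
  by [].
have z20 : (perm_mx t *m z2) 0 0 = (perm_mx t *m z) 0 0 * (perm_mx t *m z) 0 0.
  by rewrite -!row_permE !mxE tpermL eqxx.
case: r1 => r0 rs; split; rewrite z2s // z20 => a; rewrite mulrA => /r0; exact: r0.
Qed.

(** If c lifts the inverse of [eps u], then u c = 1 - g with g in the maximal ideal. [geo] with the
    constant sequence 1 gives the geometric series in g, and [sep] shows that [T 0] and [T 1]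
    coincide. *)
Lemma eps_unit u : eps u != 0 -> exists v, u * v = 1.
Proof.
move=> u0; have [c cE] := eps_onto (eps u)^-1.
pose g := 1 - u * c.
have eg : eps g = 0 by rewrite rmorphB rmorph1 rmorphM cE divff ?subrr.
have [T TE] := geo eg (fun=> 1).
have /eqP : T 0%N - T 1%N = 0.
  apply: (sep eg (b := fun n => T n - T n.+1)) => n.
  by rewrite (TE n) [X in _ - X](TE n.+1); ring.
rewrite subr_eq0 => /eqP T01; exists (c * T 0%N); apply/eqP; rewrite -subr_eq0; apply/eqP.
have := TE 0%N; rewrite -T01 /g => /eqP; rewrite -subr_eq0 => /eqP <-.
by ring.
Qed.

Lemma eps_unitmx m (A : 'M[R]_m) : map_mx eps A \in unitmx ->
  exists B, A *m B = 1%:M.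
Proof.
rewrite unitmxE det_map_mx unitfE => /eps_unit[v vE].
by exists (v *: \adj A); rewrite -scalemxAr mul_mx_adj scale_scalar_mx mulrC vE.
Qed.

End Regular.

(** * The ring of formal power series *)

Section Monomials.
Variable N : nat.
Implicit Types a b c : mi N.

Definition madd a b : mi N := [ffun i => (a i + b i)%N].
Definition msub a b : mi N := [ffun i => (a i - b i)%N].
Definition mle a b := [forall i, (a i <= b i)%N].
Definition mvar (i : 'I_N) : mi N := [ffun j => nat_of_bool (j == i)].
Definition mdeg a := (\sum_i a i)%N.
(** A list of exponents, in place of the dependent index type of [psmul], so that sums over
    different bounds can be reindexed into each other. *)
Definition below a : seq (mi N) :=
  [seq [ffun i => (b i : nat)] | b : {dffun forall i : 'I_N, 'I_(a i).+1}].

Lemma mem_below a b : (b \in below a) = mle b a.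
Proof.
apply/imageP/forallP => [[c _ ->] i|ba].
  by rewrite ffunE -ltnS.
exists [ffun i => inord (b i)] => //; apply/ffunP=> i.
by rewrite !ffunE inordK // ltnS.
Qed.

Lemma below_uniq a : uniq (below a).
Proof.
rewrite /below /image_mem map_inj_uniq ?enum_uniq // => b c /ffunP bc.
by apply/ffunP=> i; apply: val_inj; have := bc i; rewrite !ffunE.
Qed.

Lemma msubK a b : mle b a -> madd (msub a b) b = a.
Proof. by move/forallP=> ba; apply/ffunP=> i; rewrite !ffunE subnK. Qed.
Lemma maddK a b : msub (madd a b) b = a.
Proof. by apply/ffunP=> i; rewrite !ffunE addnK. Qed.
Lemma msub0 a : msub a (mi0 N) = a.
Proof. by apply/ffunP=> i; rewrite !ffunE subn0. Qed.
Lemma mle_addr a b : mle b (madd a b).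
Proof. by apply/forallP=> i; rewrite ffunE leq_addl. Qed.
Lemma mle_subr a b : mle (msub a b) a.
Proof. by apply/forallP=> i; rewrite ffunE leq_subr. Qed.
Lemma msub_subr a b : mle b a -> msub a (msub a b) = b.
Proof. by move/forallP=> ba; apply/ffunP=> i; rewrite !ffunE subKn. Qed.

Lemma mle_var i a : mle (mvar i) a = (0 < a i)%N.
Proof.
apply/forallP/idP => [/(_ i)|ai j]; first by rewrite ffunE eqxx.
by rewrite ffunE; case: eqP => [->|].
Qed.

Lemma mdeg_add a b : mdeg (madd a b) = (mdeg a + mdeg b)%N.
Proof. by rewrite /mdeg -big_split; apply: eq_bigr => i _; rewrite ffunE. Qed.
Lemma mdeg_sub a b : mle b a -> (mdeg (msub a b) + mdeg b = mdeg a)%N.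
Proof. by move=> ba; rewrite -mdeg_add msubK. Qed.
Lemma mdeg0_eq a : mdeg a = 0%N -> a = mi0 N.
Proof.
move/eqP; rewrite sum_nat_eq0 => /forallP a0; apply/ffunP=> i.
by rewrite ffunE; apply/eqP/(implyP (a0 i)).
Qed.
End Monomials.

Section Ring.
Variables (k : fieldType) (N : nat).
Implicit Types (f g h : PS k N) (a b c : mi N).

Lemma psmulE f g a : psmul f g a = \sum_(b <- below a) f b * g (msub a b).
Proof.
rewrite /psmul /below /image_mem big_map big_enum /=; apply: eq_bigr => b _.
by congr (_ * g _); apply/ffunP=> i; rewrite !ffunE.
Qed.

Definition ps1 : PS k N := fun a => (a == mi0 N)%:R.
Definition psopp f : PS k N := fun a => - f a.

Lemma psaddA : associative (@psadd k N).
Proof. by move=> f g h; apply: funext => a; apply: addrA. Qed.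
Lemma psaddC : commutative (@psadd k N).
Proof. by move=> f g; apply: funext => a; apply: addrC. Qed.
Lemma psadd0 : left_id (@ps0 k N) (@psadd k N).
Proof. by move=> f; apply: funext => a; apply: add0r. Qed.
Lemma psaddN : left_inverse (@ps0 k N) psopp (@psadd k N).
Proof. by move=> f; apply: funext => a; apply: addNr. Qed.

Lemma perm_below_sub a : perm_eq (below a) [seq msub a b | b <- below a].
Proof.
apply: uniq_perm; first exact: below_uniq.
  rewrite map_inj_in_uniq ?below_uniq // => b c; rewrite !mem_below => ba ca e.
  by rewrite -(msub_subr ba) e msub_subr.
move=> b; rewrite mem_below; apply/idP/mapP => [ba|[c]].
  by exists (msub a b); rewrite ?mem_below ?mle_subr // msub_subr.
by rewrite mem_below => ca ->; exact: mle_subr.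
Qed.

Lemma psmulC : commutative (@psmul k N).
Proof.
move=> f g; apply: funext => a; rewrite !psmulE (perm_big _ (perm_below_sub a)) big_map.
rewrite big_seq [RHS]big_seq; apply: eq_bigr => b; rewrite mem_below => ba.
by rewrite msub_subr // mulrC.
Qed.

Lemma perm_below_add a c : mle c a ->
  perm_eq [seq b <- below a | mle c b] [seq madd b c | b <- below (msub a c)].
Proof.
move=> ca; have mleP b : mle b (msub a c) = mle (madd b c) a.
  apply/forallP/forallP => ba i; have := ba i; have := forallP ca i; rewrite !ffunE; lia.
apply: uniq_perm; first by rewrite filter_uniq ?below_uniq.
  by rewrite map_inj_uniq ?below_uniq // => b d e; rewrite -(maddK b c) e maddK.
move=> b; rewrite mem_filter mem_below; apply/andP/mapP => [[cb ba]|[d]].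
  by exists (msub b c); rewrite ?mem_below ?mleP msubK.
by rewrite mem_below mleP => da ->; rewrite mle_addr.
Qed.

(** Both sides are the sum of f_c g_(b-c) h_(a-b) over chains c <= b <= a. *)
Lemma psmulA : associative (@psmul k N).
Proof.
move=> f g h; apply: funext => a; rewrite !psmulE.
transitivity (\sum_(c <- below a) \sum_(b <- below a | mle c b)
    f c * g (msub b c) * h (msub a b)).
  rewrite big_seq [RHS]big_seq; apply: eq_bigr => c; rewrite mem_below => ca.
  rewrite -big_filter (perm_big _ (perm_below_add ca)) big_map psmulE big_distrr /=.
  apply: eq_bigr => b _; rewrite maddK mulrA; congr (_ * h _).
  by apply/ffunP=> i; rewrite !ffunE addnC subnDA.
rewrite (exchange_big_dep predT) //=; rewrite big_seq [RHS]big_seq.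
apply: eq_bigr => b; rewrite mem_below => ba; rewrite psmulE big_distrl /= -big_filter.
apply: perm_big; apply: uniq_perm; rewrite ?filter_uniq ?below_uniq // => c.
rewrite mem_filter !mem_below; apply/andP/idP => [[]//|cb]; split=> //.
by apply/forallP=> i; exact: leq_trans (forallP cb i) (forallP ba i).
Qed.

Lemma psmul1 : left_id ps1 (@psmul k N).
Proof.
move=> f; apply: funext => a; rewrite psmulE (bigD1_seq (mi0 N)) ?below_uniq //=.
  rewrite /ps1 eqxx mul1r msub0 big1 ?addr0 // => b /negbTE ->; exact: mul0r.
by rewrite mem_below; apply/forallP=> i; rewrite ffunE.
Qed.

Lemma psmulDl : left_distributive (@psmul k N) (@psadd k N).
Proof.
move=> f g h; apply: funext => a; rewrite /psadd !psmulE -big_split /=.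
by apply: eq_bigr => b _; rewrite mulrDl.
Qed.

HB.instance Definition _ := gen_eqMixin (PS k N).
HB.instance Definition _ := gen_choiceMixin (PS k N).
HB.instance Definition _ := GRing.isZmodule.Build (PS k N) psaddA psaddC psadd0 psaddN.

Lemma ps1_neq0 : ps1 != 0 :> PS k N.
Proof.
apply/eqP => /(congr1 (fun f : PS k N => f (mi0 N))).
by rewrite /ps1 eqxx => /eqP; rewrite oner_eq0.
Qed.

HB.instance Definition _ := GRing.Zmodule_isComNzRing.Build (PS k N)
  psmulA psmulC psmul1 psmulDl ps1_neq0.

Lemma ps_addE f g a : (f + g) a = f a + g a. Proof. by []. Qed.
Lemma ps_oppE f a : (- f) a = - f a. Proof. by []. Qed.
Lemma ps_mulE f g a : (f * g) a = \sum_(b <- below a) f b * g (msub a b).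
Proof. exact: psmulE. Qed.
Lemma ps_sumE (I : Type) (r : seq I) (P : pred I) (F : I -> PS k N) a :
  (\sum_(i <- r | P i) F i) a = \sum_(i <- r | P i) F i a.
Proof. by elim/big_rec2: _ => // i x y _ <-. Qed.

Definition eps f : k := const_term f.

Lemma below0 : below (mi0 N) = [:: mi0 N].
Proof.
apply: perm_small_eq => //; apply: uniq_perm => //; first exact: below_uniq.
move=> b; rewrite mem_below inE; apply/forallP/eqP => [b0|-> //].
by apply/ffunP=> i; have := b0 i; rewrite !ffunE leqn0 => /eqP.
Qed.

Lemma eps_zmod : zmod_morphism eps. Proof. by []. Qed.
Lemma eps_monoid : monoid_morphism eps.
Proof.
split; first by rewrite /eps /const_term /GRing.one /= /ps1 eqxx.
by move=> f g; rewrite /eps /const_term ps_mulE below0 big_seq1 msub0.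
Qed.
HB.instance Definition _ := GRing.isZmodMorphism.Build (PS k N) k eps eps_zmod.
HB.instance Definition _ := GRing.isMonoidMorphism.Build (PS k N) k eps eps_monoid.

Definition psC (x : k) : PS k N := fun a => if a == mi0 N then x else 0.

Lemma eps_psC (x : k) : eps (psC x) = x.
Proof. by rewrite /eps /const_term /psC eqxx. Qed.

Lemma psCM (x : k) f a : (psC x * f) a = x * f a.
Proof.
rewrite ps_mulE (bigD1_seq (mi0 N)) ?below_uniq //=.
  rewrite /psC eqxx msub0 big1 ?addr0 // => b /negbTE ->; exact: mul0r.
by rewrite mem_below; apply/forallP=> i; rewrite ffunE.
Qed.

Lemma psXE i a : psX k i a = (a == mvar i)%:R.
Proof. by rewrite /psX; case: eqP. Qed.

Lemma psXM i f a : (psX k i * f) a = if (0 < a i)%N then f (msub a (mvar i)) else 0.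
Proof.
rewrite ps_mulE; case: ifP => ai.
  rewrite (bigD1_seq (mvar i)) ?below_uniq ?mem_below ?mle_var //= psXE eqxx mul1r.
  by rewrite big1 ?addr0 // => b /negbTE bi; rewrite psXE bi mul0r.
rewrite big_seq big1 // => b; rewrite mem_below psXE; case: eqP => [->|_ _];
  last by rewrite mul0r.
by rewrite mle_var ai.
Qed.

Definition ordge n f := forall a, (mdeg a < n)%N -> f a = 0.

Lemma ordgeM m n f g : ordge m f -> ordge n g -> ordge (m + n) (f * g).
Proof.
move=> fm gn a an; rewrite ps_mulE big_seq big1 // => b; rewrite mem_below => ba.
have := mdeg_sub ba; case: (ltnP (mdeg b) m) => bm e; first by rewrite fm ?mul0r.
by rewrite gn ?mulr0 //; lia.
Qed.

Lemma ordgeD n f g : ordge n f -> ordge n g -> ordge n (f + g).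
Proof. by move=> fn gn a an; rewrite ps_addE fn ?gn ?addr0. Qed.

Lemma ordge_exp z n : eps z = 0 -> ordge n (z ^+ n).
Proof.
move=> z0; elim: n => [|n IH]; first by [].
rewrite exprS -add1n; apply: ordgeM => // a; rewrite ltnS leqn0 => /eqP/mdeg0_eq ->.
exact: z0.
Qed.

Lemma ordge_inf f : (forall n, ordge n f) -> f = 0.
Proof. by move=> f0; apply: funext => a; apply: (f0 (mdeg a).+1). Qed.

Lemma ps_sep z : eps z = 0 -> forall b : nat -> PS k N,
  (forall n, b n = z * b n.+1) -> b 0%N = 0.
Proof.
move=> z0 b bE; have be n : b 0%N = z ^+ n * b n.
  by elim: n => [|n IH]; rewrite ?mul1r // IH exprSr -mulrA -bE.
apply: ordge_inf => n; rewrite (be n) -[X in ordge X](addn0 n).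
by apply: ordgeM => //; exact: ordge_exp.
Qed.

(* [T n] is the convergent sum of the [z^i s_(n+i)]. *)
Lemma ps_geo z : eps z = 0 -> forall s : nat -> PS k N,
  exists T : nat -> PS k N, forall n, T n = s n + z * T n.+1.
Proof.
move=> z0 s; pose P n M : PS k N := \sum_(i < M) z ^+ i * s (n + i)%N.
(* The terms with i > [mdeg a] have order above [mdeg a], so the coefficient at a is that of a
   finite partial sum. *)
pose T n : PS k N := fun a => P n (mdeg a).+1 a.
have PT n M : ordge M (T n - P n M).
  move=> a aM; rewrite ps_addE ps_oppE /T; apply/eqP; rewrite subr_eq0 eq_sym; apply/eqP.
  rewrite /P !ps_sumE -(subnKC aM) big_split_ord /= [X in _ + X]big1 ?addr0 // => i _.
  have : ordge ((mdeg a).+1 + i + 0) (z ^+ ((mdeg a).+1 + i) * s (n + ((mdeg a).+1 + i))%N).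
    by apply: ordgeM => //; exact: ordge_exp.
  by apply; lia.
exists T => n; apply/eqP; rewrite -subr_eq0; apply/eqP/ordge_inf => M.
have -> : T n - (s n + z * T n.+1) = (T n - P n M.+1) + - z * (T n.+1 - P n.+1 M).
  have -> : P n M.+1 = s n + z * P n.+1 M.
    rewrite /P big_ord_recl expr0 mul1r addn0 big_distrr /=; congr (_ + _).
    by apply: eq_bigr => i _; rewrite exprS mulrA addnS.
  by ring.
apply: ordgeD; first by move=> a aM; apply: (PT n M.+1); exact: leqW.
by rewrite -[M]add0n; apply: ordgeM.
Qed.

End Ring.

(** * Ideals of power series, variables and linear parts *)

Section Ideals.
Variables (k : fieldType) (N : nat).
Implicit Types (f g h : PS k N) (a b : mi N) (S J : PS k N -> Prop)
  (D : pred 'I_N).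

Lemma pssumE m (F : 'I_m -> PS k N) : pssum F = \sum_j F j.
Proof. by []. Qed.

Lemma ideal_sum J (I : Type) (r : seq I) (P : pred I) (F : I -> PS k N) : is_ideal J ->
  (forall i, P i -> J (F i)) -> J (\sum_(i <- r | P i) F i).
Proof. by move=> [J0 JD _] JF; elim/big_ind: _. Qed.

Lemma ideal_opp J f : is_ideal J -> J f -> J (- f).
Proof. by move=> [_ _ JM] Jf; rewrite -mulN1r; exact: JM. Qed.

Lemma ideal_sub J f g : is_ideal J -> J f -> J g -> J (f - g).
Proof. by move=> iJ Jf Jg; case: (iJ) => _ JD _; apply: JD => //; exact: ideal_opp. Qed.

Lemma ideal_gen_mem S f : S f -> ideal_gen S f.
Proof.
move=> Sf; exists 1%N, (fun=> 1), (fun=> f); split=> //.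
by rewrite pssumE big_ord1; exact: esym (mul1r f).
Qed.

Lemma ideal_gen_ideal S : is_ideal (ideal_gen S).
Proof.
split.
- by exists 0%N, (fun=> 0), (fun=> 0); split; [case | rewrite pssumE big_ord0].
- move=> f g [m [r [s [Ss ->]]]] [m' [r' [s' [Ss' ->]]]].
  exists (m + m')%N, (fun j => match split j with inl i => r i | inr i => r' i end),
    (fun j => match split j with inl i => s i | inr i => s' i end); split.
    by move=> j; case: (split j).
  rewrite !pssumE big_split_ord; congr (_ + _); apply: eq_bigr => i _.
    by rewrite (unsplitK (inl i)).
  by rewrite (unsplitK (inr i)).
move=> t f [m [r [s [Ss ->]]]]; exists m, (fun j => t * r j), s; split=> //.
rewrite !pssumE -[psmul _ _]/(t * _) big_distrr; apply: eq_bigr => j _; exact: mulrA.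
Qed.

Lemma ideal_gen_sub S J : is_ideal J -> (forall f, S f -> J f) ->
  forall f, ideal_gen S f -> J f.
Proof.
move=> iJ SJ _ [m [r [s [Ss ->]]]]; rewrite pssumE; apply: ideal_sum => // j _.
by case: iJ => _ _; apply; exact: SJ.
Qed.

Lemma adjoin_ideal J m (z : 'cV[PS k N]_m) : is_ideal J -> is_ideal (adjoin J z).
Proof.
move=> [J0 JD JM]; split.
- by exists 0, 0; split=> //; rewrite mul0mx mxE; exact: esym (addr0 _).
- move=> _ _ [a [w [Ja ->]]] [b [v [Jb ->]]]; exists (a + b), (w + v); split; first exact: JD.
  by rewrite mulmxDl [X in _ = _ + X]mxE; exact: addrACA.
move=> r _ [a [w [Ja ->]]]; exists (r * a), (r *: w); split; first exact: JM.
by rewrite -scalemxAl [X in _ = _ + X]mxE; exact: mulrDr.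
Qed.

Lemma adjoin_mem J m (z : 'cV[PS k N]_m) i : is_ideal J -> adjoin J z (z i 0).
Proof.
move=> [J0 _ _]; exists 0, (delta_mx 0 i); split=> //.
by rewrite -rowE mxE add0r.
Qed.

Lemma zero_ideal : is_ideal (fun f : PS k N => f = 0).
Proof. by split=> [|f g -> ->|r f ->] //; [exact: addr0 | exact: mulr0]. Qed.

(** The ideal generated by the variables in [D], described by coefficients. *)
Definition vanish (D : pred 'I_N) f := forall a, (forall i, D i -> a i = 0%N) -> f a = 0.

Lemma vanish_ideal D : is_ideal (vanish D).
Proof.
split=> [a _ //|f g f0 g0 a a0|r f f0 a a0].
  by rewrite [LHS]ps_addE f0 ?g0 ?addr0.
rewrite [LHS]ps_mulE big1 // => b _; rewrite f0 ?mulr0 // => i Di.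
by rewrite ffunE a0.
Qed.

Lemma vanish_X D (i : 'I_N) : D i -> vanish D (psX k i).
Proof.
move=> Di a a0; rewrite psXE; case: eqP => // e.
by have := a0 i Di; rewrite e ffunE eqxx.
Qed.

(** Each monomial of f is divided by its least variable in [D]. The second clause lets the quotients
    inherit vanishing conditions from f, as needed to intersect two such ideals. *)
Lemma vanish_decomp D f : vanish D f -> exists F : 'I_N -> PS k N,
  f = \sum_(i | D i) psX k i * F i /\
  forall i a, F i a = f (madd a (mvar i)) \/ F i a = 0.
Proof.
move=> f0.
pose F (i : 'I_N) : PS k N := fun a =>
  if [forall j, D j && (j < i)%N ==> (a j == 0%N)] then f (madd a (mvar i)) else 0.
exists F; split; last by move=> i a; rewrite /F; case: ifP; [left|right].
apply: funext => a; rewrite ps_sumE.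
case: (pickP (fun i => D i && (0 < a i)%N)) => [i1 i1P|a0]; last first.
  rewrite big1 => [|i Di]; first by apply: f0 => i Di; have := a0 i; rewrite Di; case: (a i).
  by rewrite psXM; have := a0 i; rewrite Di /= => ->.
case: (@arg_minnP _ i1 (fun i => D i && (0 < a i)%N) (fun i : 'I_N => i : nat) i1P).
move=> i /andP[Di ai] imin.
rewrite (bigD1 i) //= psXM ai /F msubK ?mle_var //.
case: forallP => [_|[j]]; last first.
  apply/implyP=> /andP[Dj ji]; rewrite !ffunE; apply/eqP.
  rewrite (_ : a j = 0%N) //; apply/eqP; rewrite -leqn0 leqNgt; apply/negP=> aj.
  by have := imin j; rewrite Dj aj => /(_ isT); rewrite leqNgt ji.
rewrite big1 ?addr0 // => j /andP[Dj ji]; rewrite psXM; case: ifP => // aj.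
case: forallP => // /(_ i); rewrite Di /= => H.
have ij : (i < j)%N by rewrite ltn_neqAle eq_sym -val_eqE /= in ji *; rewrite ji imin // Dj.
move: H; rewrite ij !ffunE (_ : (i == j) = false) ?subn0; last by apply/eqP => e;
  rewrite e ltnn in ij.
by move/eqP=> e; rewrite e in ai.
Qed.

(* Division by X_j, linear over the series that do not involve X_j. *)
Definition sh (j : 'I_N) f : PS k N := fun a => f (madd a (mvar j)).

Lemma shD j f g : sh j (f + g) = sh j f + sh j g.
Proof. by []. Qed.

Lemma sh_sum j (I : Type) (r : seq I) (P : pred I) (F : I -> PS k N) :
  sh j (\sum_(i <- r | P i) F i) = \sum_(i <- r | P i) sh j (F i).
Proof. by elim/big_rec2: _ => // i x y _ <-. Qed.

Lemma sh_X j f : sh j (f * psX k j) = f.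
Proof.
apply: funext => a; rewrite /sh mulrC psXM maddK.
by rewrite !ffunE eqxx addn1.
Qed.

Lemma sh_mul j r h : (forall a, (0 < a j)%N -> h a = 0) -> sh j (r * h) = sh j r * h.
Proof.
move=> h0; apply: funext => a; rewrite /sh !ps_mulE.
rewrite (bigID (fun b : mi N => mle (mvar j) b)) /= [X in _ + X]big1 ?addr0; last first.
  by move=> b; rewrite mle_var -eqn0Ngt => /eqP bj;
    rewrite h0 ?mulr0 // !ffunE bj eqxx subn0 addn1.
rewrite -big_filter (perm_big _ (perm_below_add (mle_addr a (mvar j)))) big_map maddK.
apply: eq_bigr => b _; congr (_ * h _).
by apply/ffunP=> i; rewrite !ffunE subnDr.
Qed.

(** If f X = b + w z, where X is the first variable, then [sh] recovers f on the left, keeps b in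
    [J], and commutes with multiplication by the remaining variables. *)
Lemma regular_vars J m (s : 'I_m -> 'I_N) : injective s -> is_ideal J ->
  (forall i f, J f -> J (sh (s i) f)) -> regular J (\col_i psX k (s i)).
Proof.
move=> + iJ; elim: m s => [|m IH] s s_inj Jsh //.
have tE : dsubmx (\col_i psX k (s i) : 'cV_(1 + m)) = \col_i psX k (s (rshift 1 i)).
  by apply/colP=> i; rewrite !mxE.
split; rewrite tE; last by apply: IH => [i j /s_inj/(@rshift_inj 1 m)//|i f /Jsh].
move=> f [b [w [Jb e]]]; exists (sh (s ord0) b), (map_mx (sh (s ord0)) w); split;
  first exact: Jsh.
move: e => /(congr1 (sh (s ord0))); rewrite mxE sh_X => ->; rewrite shD; congr (_ + _).
rewrite !mxE sh_sum; apply: eq_bigr => i _; rewrite !mxE sh_mul // => a ai.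
rewrite psXE; case: eqP => // ae; move: ai; rewrite ae ffunE;
  case: eqP => // /s_inj /(congr1 val).
by [].
Qed.

Lemma eps_X (i : 'I_N) : eps (psX k i) = 0.
Proof.
rewrite /eps /const_term psXE; case: eqP => // /ffunP/(_ i); by rewrite !ffunE eqxx.
Qed.

Lemma vanishT f : vanish predT f <-> eps f = 0.
Proof.
split=> [f0|f0 a a0]; first by apply: f0 => i _; rewrite ffunE.
by rewrite -f0; congr f; apply/ffunP=> i; rewrite ffunE a0.
Qed.

Lemma eps_ideal : is_ideal (fun f => eps f = 0).
Proof.
by split=> [//|f g f0 g0|r f f0];
  [rewrite [eps _]rmorphD /= f0 g0 addr0 | rewrite [eps _]rmorphM /= f0 mulr0].
Qed.

Lemma eps_sum0 (I : Type) (r : seq I) (P : pred I) (F : I -> PS k N) :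
  (forall i, P i -> eps (F i) = 0) -> eps (\sum_(i <- r | P i) F i) = 0.
Proof. exact: (ideal_sum (J := fun f => eps f = 0) r eps_ideal). Qed.

Lemma max_idealE f : max_ideal f <-> eps f = 0.
Proof.
split=> [|/vanishT/vanish_decomp[F [-> _]]].
  by apply: (ideal_gen_sub (J := fun f => eps f = 0)) => [|_ [i ->]];
    [exact: eps_ideal | exact: eps_X].
apply: ideal_sum; first exact: ideal_gen_ideal.
move=> i _; rewrite mulrC; case: (ideal_gen_ideal (fun f => exists i, f = psX k i)) => _ _;
  apply.
by apply: ideal_gen_mem; exists i.
Qed.

(** For f in the maximal ideal, the class of f modulo its square. *)
Definition linpart f : 'rV[k]_N := \row_j f (mvar j).

Lemma linpartD f g : linpart (f + g) = linpart f + linpart g.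
Proof. by apply/rowP=> j; rewrite !mxE. Qed.
Lemma linpart_sum (I : Type) (r : seq I) (P : pred I) (F : I -> PS k N) :
  linpart (\sum_(i <- r | P i) F i) = \sum_(i <- r | P i) linpart (F i).
Proof.
elim/big_rec2: _ => [|i x y _ <-]; last by rewrite linpartD.
by apply/rowP=> j; rewrite !mxE.
Qed.
Lemma linpartC (c : k) f : linpart (psC c * f) = c *: linpart f.
Proof. by apply/rowP=> j; rewrite !mxE psCM. Qed.

Lemma linpartXM (i : 'I_N) f : linpart (psX k i * f) = eps f *: delta_mx 0 i.
Proof.
apply/rowP=> j; rewrite !mxE psXM ffunE (eq_sym i j) eqxx /=.
case: eqP => [<-|_]; last by rewrite mulr0.
by rewrite mulr1; congr f; apply/ffunP=> l; rewrite !ffunE subnn.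
Qed.

Lemma linpart_var_sum (F : 'I_N -> PS k N) i : linpart (\sum_j psX k j * F j) 0 i = eps (F i).
Proof.
rewrite linpart_sum summxE (bigD1 i) //= linpartXM !mxE !eqxx mulr1 big1 ?addr0 // => j ji.
by rewrite linpartXM !mxE eq_sym (negbTE ji) andbF mulr0.
Qed.

Lemma linpartM r f : eps f = 0 -> linpart (r * f) = eps r *: linpart f.
Proof.
move/vanishT/vanish_decomp=> [F [-> _]]; apply/rowP=> i.
rewrite big_distrr /=; under eq_bigr do rewrite mulrCA.
by rewrite linpart_var_sum mxE linpart_var_sum rmorphM.
Qed.

Lemma max_ideal_sqE f : max_ideal_sq f <-> eps f = 0 /\ linpart f = 0.
Proof.
split.
  apply: (ideal_gen_sub (J := fun f => eps f = 0 /\ linpart f = 0)).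
    split=> [|g h [g0 lg] [h0 lh]|r g [g0 lg]].
    - by split=> //; apply/rowP=> j; rewrite !mxE.
    - split; first by rewrite [eps _]rmorphD /= g0 h0 addr0.
      by rewrite [linpart _]linpartD lg lh addr0.
    split; first by rewrite [eps _]rmorphM /= g0 mulr0.
    by rewrite [linpart _]linpartM // lg scaler0.
  move=> _ [i [j ->]]; split; first by rewrite [eps _]rmorphM /= eps_X mul0r.
  by rewrite [linpart _]linpartXM eps_X scale0r.
move=> [/vanishT/vanish_decomp[F [-> _]] /rowP l0].
apply: ideal_sum => [|i _]; first exact: ideal_gen_ideal.
have /max_idealE : eps (F i) = 0 by have := l0 i; rewrite linpart_var_sum mxE.
move/(ideal_gen_sub (J := fun g => max_ideal_sq (psX k i * g))); apply.
  have [M0 MD MM] := ideal_gen_ideal (fun f => exists i j, f = psmul (psX k i) (psX k j)).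
  split=> [|g h Jg Jh|r g Jg].
  - by rewrite [psX k i * _]mulr0.
  - by rewrite [psX k i * _]mulrDr; exact: MD.
  by rewrite [psX k i * _]mulrCA; exact: MM.
by move=> _ [j ->]; apply: ideal_gen_mem; exists i, j.
Qed.

End Ideals.

(** * Regular systems of parameters *)

Section SystemOfParameters.
Variables (k : fieldType) (N : nat) (z : 'cV[PS k N]_N).
Let L : 'M[k]_N := \matrix_(i, j) linpart (z i 0) 0 j.
Hypothesis ez : forall j, eps (z j 0) = 0.
Hypothesis Lu : L \in unitmx.
Let J0 (r : PS k N) := r = 0.
Let Xc : 'cV[PS k N]_N := \col_i psX k i.

Lemma eps_onto (c : k) : exists u : PS k N, eps u = c.
Proof. by exists (psC c); exact: eps_psC. Qed.

Lemma var_expand (f : PS k N) : eps f = 0 ->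
  exists w : 'rV_N, f = (w *m Xc) 0 0 /\ map_mx (@eps k N) w = linpart f.
Proof.
move/vanishT/vanish_decomp=> [F [-> _]]; exists (\row_i F i); split.
  by rewrite mxE; apply: eq_bigr => i _; rewrite !mxE mulrC.
by apply/rowP=> i; rewrite linpart_var_sum !mxE.
Qed.

(** Expanding the parameters in the variables gives a matrix that reduces to [L]; over a local ring
    it is then invertible. *)
Lemma param_matrix : exists A B : 'M[PS k N]_N, z = A *m Xc /\ A *m B = 1%:M.
Proof.
have /fin_all_exists[w wE] : forall j, exists w : 'rV_N,
    z j 0 = (w *m Xc) 0 0 /\ map_mx (@eps k N) w = linpart (z j 0).
  by move=> j; exact: var_expand.
pose A := \matrix_j w j; have rA j : row j A = w j by rewrite rowK.
have [|B AB] := @eps_unitmx _ _ (@eps k N) (@ps_geo k N) (@ps_sep k N) eps_onto _ A.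
  rewrite (_ : map_mx _ A = L) //; apply/row_matrixP=> j; rewrite -map_row rA.
  by have [_ ->] := wE j; apply/rowP=> i; rewrite !mxE.
exists A, B; split=> //; apply/colP=> j; have [-> _] := wE j.
by rewrite -rA -row_mul !mxE.
Qed.

Lemma param_syz : trivial_syz z.
Proof.
have [A [B [-> AB]]] := param_matrix; apply: syz_GL AB _.
apply: regular_syz; apply: (regular_vars (s := id)) => //; first exact: zero_ideal.
by move=> i f ->.
Qed.

Lemma param_regular : regular J0 z.
Proof. apply: (syz_regular (@ps_geo k N) (@ps_sep k N) ez); exact: param_syz. Qed.

Lemma param_regular_sq j : regular J0 (colmul (sq_col z j) z).
Proof. apply: (regular_sq (@ps_geo k N) (@ps_sep k N)) => //; exact: param_syz. Qed.

Lemma param_gen f : adjoin J0 z f <-> eps f = 0.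
Proof.
split=> [[a [w [-> ->]]]|/var_expand[w [-> _]]].
  rewrite add0r mxE; apply: eps_sum0.
  by move=> j _; rewrite [eps _]rmorphM /= ez mulr0.
have [A [B [zE /mulmx1C BA]]] := param_matrix.
by exists 0, (w *m B); split=> //; rewrite add0r zE -mulmxA (mulmxA B) BA mul1mx.
Qed.

(** Subtracting the combination g of the z_i with i <> j leaves an element of the squared maximal
    ideal. That ideal is spanned by the products z_l z_i, each of which is z_j^2 or has a factor
    other than z_j. *)
Lemma param_sq f j c : eps f = 0 -> linpart f = c *m L -> c 0 j = 0 ->
  adjoin J0 (colmul (sq_col z j) z) f.
Proof.
move=> f0 fL cj; set K := adjoin J0 _.
have iK : is_ideal K := adjoin_ideal _ (@zero_ideal k N).
have [K0 KD KM] := iK.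
have Kz i : i != j -> K (z i 0).
  have := @adjoin_mem k N _ _ (colmul (sq_col z j) z) i (@zero_ideal k N).
  by rewrite mxE [sq_col _ _ _ _]mxE => + /negbTE ij; rewrite ij mul1r.
have Kzz : K (z j 0 * z j 0).
  have := @adjoin_mem k N _ _ (colmul (sq_col z j) z) j (@zero_ideal k N).
  by rewrite mxE [sq_col _ _ _ _]mxE eqxx.
pose g := \sum_i psC (c 0 i) * z i 0.
have Kg : K g.
  apply: ideal_sum => // i _; case: (eqVneq i j) => [->|ij]; last exact: KM (Kz _ ij).
  rewrite cj (_ : psC 0 = 0) ?mul0r //.
  by apply: funext => a; rewrite /psC; case: eqP.
have eg : eps g = 0.
  apply: eps_sum0.
  by move=> i _; rewrite [eps _]rmorphM /= ez mulr0.
rewrite -(subrK g f); apply: KD => //.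
have e0 : eps (f - g) = 0 by rewrite [eps _]rmorphB /= f0 eg subrr.
have l0 : linpart (f - g) = 0.
  have -> : linpart (f - g) = linpart f - linpart g by apply/rowP=> i; rewrite !mxE.
  apply/eqP; rewrite subr_eq0 fL; apply/eqP/rowP=> i; rewrite linpart_sum mxE summxE.
  by apply: eq_bigr => l _; rewrite linpartC !mxE.
have [w [wE]] := var_expand e0; rewrite l0 wE => wl.
have [A [B [zE /mulmx1C BA]]] := param_matrix.
have -> : w *m Xc = (w *m B) *m z by rewrite zE -mulmxA (mulmxA B) BA mul1mx.
rewrite mxE; apply: ideal_sum => // i _.
have [] : adjoin J0 z ((w *m B) 0 i).
  apply/param_gen; rewrite mxE; apply: eps_sum0.
  move=> l _; have /rowP/(_ l) := wl; rewrite !mxE => e.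
  by rewrite [eps _]rmorphM /= e mul0r.
move=> _ [v [-> ->]]; rewrite add0r mxE big_distrl /=.
apply: ideal_sum => // l _; rewrite -mulrA; apply: (KM (v 0 l)).
case: (eqVneq i j) => [->|ij]; last exact: KM (Kz _ ij).
by case: (eqVneq l j) => [->|lj] //; rewrite mulrC; exact: KM (Kz _ lj).
Qed.

End SystemOfParameters.

Lemma sum_ltn n p : (p <= n)%N -> (\sum_(i < n) (i < p) = p)%N.
Proof.
move=> /subnKC <-; rewrite big_split_ord /= (eq_bigr (fun=> 1%N)) => [|i _];
  last by rewrite ltn_ord.
by rewrite sum1_card card_ord big1 ?addn0 // => i _; rewrite ltnNge leq_addr.
Qed.

(** The linear parts of [I] form a p-dimensional space. A basis of it lifts to [I], and a
    complementary basis lifts to linear forms. *)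
Lemma adapted_params (k : fieldType) n (I : PS k n -> Prop) p :
  is_ideal I -> (forall f, I f -> eps f = 0) ->
  quot_dim (ideal_add I (@max_ideal_sq k n)) (@max_ideal_sq k n) p ->
  exists (z : 'I_n -> PS k n) (s : pred 'I_n),
    let L := \matrix_(i, j) linpart (z i) 0 j in
  [/\ (\sum_i s i = p)%N, forall i, eps (z i) = 0, forall i, s i -> I (z i), L \in unitmx
    & forall f, I f -> exists c, linpart f = c *m L /\ forall j, ~~ s j -> c 0 j = 0].
Proof.
move=> iI Im [[v [vA vI]] maxI].
have iM : is_ideal (@max_ideal_sq k n) by exact: ideal_gen_ideal.
have linpart_scale m (c : 'I_m -> k) (u : 'I_m -> PS k n) :
    linpart (pssum (fun j => psscale (c j) (u j))) = (\row_j c j) *m (\matrix_j linpart (u j)).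
  rewrite pssumE linpart_sum mulmx_sum_row; apply: eq_bigr => j _.
  by rewrite rowK mxE; apply/rowP=> i; rewrite !mxE.
have eps_scale m (c : 'I_m -> k) (u : 'I_m -> PS k n) : (forall j, eps (u j) = 0) ->
    eps (pssum (fun j => psscale (c j) (u j))) = 0.
  move=> u0; rewrite pssumE; apply: eps_sum0.
  by move=> j _; exact: etrans (congr1 ( *%R (c j)) (u0 j)) (mulr0 _).
(* Each basis vector is replaced by its component in [I], which has the same linear part. *)
have /fin_all_exists[a aP] : forall j, exists a, [/\ I a, eps (v j) = 0 & linpart (v j) =
  linpart a].
  move=> j; have [a [b [Ia /max_ideal_sqE[b0 lb] ->]]] := vA j; exists a; split=> //.
    by rewrite [eps _]rmorphD /= b0 Im // addr0.
  by rewrite [LHS]linpartD lb addr0.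
have Ia j : I (a j) by case: (aP j).
pose V : 'M[k]_(p, n) := \matrix_j linpart (a j).
have vV : \matrix_j linpart (v j) = V by apply/row_matrixP=> j; rewrite !rowK; case: (aP j).
have Vfree : row_free V.
  apply: inj_row_free => c cV; apply/rowP=> j; rewrite [RHS]mxE.
  apply: (vI (fun j => c 0 j)); apply/max_ideal_sqE; split.
    by apply: eps_scale => l; case: (aP l).
  rewrite linpart_scale vV -[RHS]cV; congr (_ *m _); by apply/rowP=> l; rewrite mxE.
(* Otherwise f and the [a j] would be p + 1 independent elements, contradicting the choice of p. *)
have VI f : I f -> (linpart f <= V)%MS.
  move=> If; apply: contra_notT maxI => fV.
  exists (fun j => if unlift ord0 j is Some j' then a j' else f); split.
    move=> j; exists (if unlift ord0 j is Some j' then a j' else f), 0; split.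
    - by case: (unlift _ _).
    - by case: iM.
    by exact: esym (addr0 _).
  move=> c /max_ideal_sqE[_]; rewrite linpart_scale.
  rewrite mulmx_sum_row big_ord_recl rowK unlift_none mxE.
  have -> : \sum_(i < p) (\row_j c j) 0 (lift ord0 i) *: row (lift ord0 i) (\matrix_j
     linpart (if unlift ord0 j is Some j' then a j' else f)) = (\row_j c (lift ord0 j)) *m V.
    by rewrite mulmx_sum_row; apply: eq_bigr => i _; rewrite !rowK liftK !mxE.
  move=> e; have c0 : c ord0 = 0.
    apply/eqP; apply: contraNT fV => c0.
    have -> : linpart f = (- (c ord0)^-1 *: (\row_j c (lift ord0 j))) *m V.
      apply: (scalerI c0); rewrite -scalemxAl scalerA mulrN divff // scaleN1r.
      by apply/eqP; rewrite -addr_eq0 e.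
    exact: submxMl.
  move: e; rewrite c0 scale0r add0r => e j; case: (unliftP ord0 j) => [j' ->|-> //].
  have := row_free_inj Vfree; move/(_ _ (\row_j c (lift ord0 j)) 0).
  by rewrite e mul0mx => /(_ erefl)/rowP/(_ j'); rewrite !mxE.
have rV : \rank V = p by apply/eqP.
have pn : (p <= n)%N by rewrite -rV rank_leq_col.
pose E := row_ebase V; pose C := col_ebase V.
have Cu : C \in unitmx by exact: col_ebase_unit.
have Eu : E \in unitmx by exact: row_ebase_unit.
have VE : V = C *m pid_mx p *m E by rewrite -[LHS]mulmx_ebase rV.
(* [M] writes the first p rows of the invertible matrix [E] in terms of the rows of [V], so these
   are linear parts of elements of [I]; the remaining rows of [E] are the coefficients of the linear
   forms. *)
pose M : 'M[k]_(n, p) := pid_mx p *m invmx C.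
have MV : M *m V = pid_mx p *m E.
  rewrite VE /M !mulmxA mulmxKV // mul_pid_mx.
  by rewrite !minnn.
pose z (i : 'I_n) : PS k n := if (i < p)%N then \sum_j psC (M i j) * a j
  else \sum_j psC (E i j) * psX k j.
have lamz i : linpart (z i) = row i E.
  rewrite /z; case: ifP => ip.
    transitivity (row i (M *m V)).
      rewrite linpart_sum row_mul mulmx_sum_row; apply: eq_bigr => j _.
      by rewrite linpartC rowK [row i M 0 j]mxE.
    rewrite MV; apply/rowP=> j;
      rewrite !mxE (bigD1 i) //= mxE eqxx ip mul1r big1 ?addr0 // => l li.
    by rewrite mxE val_eqE eq_sym (negbTE li) mul0r.
  rewrite linpart_sum; apply/rowP=> j; rewrite summxE (bigD1 j) //= !mxE psCM.
  rewrite psXE eqxx mulr1 big1 ?addr0 // => l lj; rewrite mxE psCM psXE.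
  case: eqP => [/ffunP/(_ l)|_]; last by rewrite mulr0.
  by rewrite !ffunE eqxx (negbTE lj).
exists z, (fun i : 'I_n => (i < p)%N) => /=.
have LE : \matrix_(i, j) linpart (z i) 0 j = E.
  by apply/matrixP=> i j; rewrite mxE lamz mxE.
rewrite LE; split=> //.
- exact: sum_ltn.
- move=> i; rewrite /z; case: ifP => _; apply: eps_sum0.
    by move=> j _; rewrite [eps _]rmorphM /= (Im _ (Ia j)) mulr0.
  by move=> j _; rewrite [eps _]rmorphM /= eps_X mulr0.
- move=> i ip; rewrite /z ip; apply: ideal_sum => // j _.
  by case: iI => _ _; apply.
move=> f /VI/submxP[u uE]; exists (u *m C *m pid_mx p); split.
  by rewrite uE VE !mulmxA.
move=> j; rewrite -leqNgt => pj; rewrite mxE big1 // => l _; rewrite mxE.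
rewrite [pid_mx _ _ _]mxE (ltn_eqF (leq_trans (ltn_ord l) pj)) mulr0 //.
Qed.

(** * Ideals extended from fewer variables, and the fiber product *)

Section Extension.
(* Common to [ext_x] and [ext_y]: [s] embeds the variables, [t] enumerates the
   other ones. *)
Variables (k : fieldType) (n N l : nat) (s : 'I_n -> 'I_N) (t : 'I_l -> 'I_N).
Variable e : PS k n -> PS k N.
Hypothesis eE : forall f a, e f a =
  if [forall j, a (t j) == 0%N] then f [ffun i => a (s i)] else 0.
Hypotheses (s_inj : injective s) (t_inj : injective t) (st : forall i j, s i <> t j).
Variable I : PS k n -> Prop.
Hypothesis I0 : forall f, I f -> eps f = 0.

Definition image_pred (m : nat) (r : 'I_m -> 'I_N) : pred 'I_N := [pred i | i \in codom r].
Let extI := ideal_gen (fun f => exists g, I g /\ f = e g).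
Let tcol : 'cV[PS k N]_l := \col_j psX k (t j).

Lemma eps_ext f : eps (e f) = eps f.
Proof.
rewrite /eps /const_term eE; case: forallP => [_|[]]; last by move=> j; rewrite ffunE.
by congr f; apply/ffunP=> i; rewrite !ffunE.
Qed.

Lemma linpart_ext_s f i : linpart (e f) 0 (s i) = linpart f 0 i.
Proof.
rewrite !mxE eE; case: forallP => [_|[]].
  by congr f; apply/ffunP=> j; rewrite !ffunE (inj_eq s_inj).
by move=> j; rewrite ffunE; case: (eqVneq (t j) (s i)) => // tj; case: (st (esym tj)).
Qed.

Lemma linpart_ext_t f j : linpart (e f) 0 (t j) = 0.
Proof.
rewrite !mxE eE; case: forallP => // /(_ j); by rewrite ffunE eqxx.
Qed.

Lemma ext_vanish f : eps f = 0 -> vanish (image_pred s) (e f).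
Proof.
move=> f0 a a0; rewrite eE; case: ifP => // _; rewrite -[RHS]f0; congr f.
by apply/ffunP=> i; rewrite !ffunE; apply: a0; exact: codom_f.
Qed.

Lemma ext_ideal_vanish f : extI f -> vanish (image_pred s) f.
Proof.
apply: ideal_gen_sub; first exact: vanish_ideal.
by move=> _ [g [Ig ->]]; apply: ext_vanish; exact: I0.
Qed.

(** The generators of the extended ideal do not involve the new variables, so the ideal is stable
    under dividing by them with [sh]. *)
Lemma ext_regular : regular extI tcol.
Proof.
apply: regular_vars => //; first exact: ideal_gen_ideal.
move=> j f [m [r [g [gP ->]]]]; rewrite pssumE sh_sum.
apply: ideal_sum; first exact: ideal_gen_ideal.
move=> i _; rewrite -[psmul _ _]/(r i * g i) sh_mul; last first.
  move=> a aj; have [h [_ ->]] := gP i; rewrite eE; case: forallP => // /(_ j).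
  by rewrite -leqn0 leqNgt aj.
by case: (ideal_gen_ideal (fun f => exists g, I g /\ f = e g)) => _ _; apply;
  exact: ideal_gen_mem.
Qed.

Lemma vanish_span m (r : 'I_m -> 'I_N) (f : PS k N) : injective r ->
  vanish (image_pred r) f <-> exists w : 'rV_m, f = (w *m \col_j psX k (r j)) 0 0.
Proof.
move=> r_inj; split=> [/vanish_decomp[F [-> _]]|[w ->]].
  exists (\row_j F (r j)); rewrite mxE.
  transitivity (\sum_(i <- codom r) psX k i * F i).
    by rewrite big_uniq //; exact/injectiveP.
  by rewrite big_image /=; apply: eq_bigr => j _; rewrite !mxE mulrC.
rewrite mxE; apply: ideal_sum; first exact: vanish_ideal.
move=> j _; rewrite mxE; case: (vanish_ideal k (image_pred r)) => _ _; apply.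
by apply: vanish_X; exact: codom_f.
Qed.

Lemma adjoin_ext f : adjoin extI tcol f <->
  exists a b, [/\ extI a, vanish (image_pred t) b & f = a + b].
Proof.
split=> [[a [w [Ia ->]]]|[a [b [Ia /(vanish_span _ t_inj)[w ->] ->]]]]; last by exists a, w.
exists a, ((w *m tcol) 0 0); split=> //; apply/vanish_span => //; by exists w.
Qed.

End Extension.

(** The inclusion of (x) ∩ (y) in (xy): the quotients by the x_i have coefficients of f or 0 as
    coefficients, hence lie in (y) and decompose again. *)
Lemma xy_idealE (k : fieldType) n n' (f : PS k (n + n')) :
  vanish (image_pred (@lshift n n')) f -> vanish (image_pred (@rshift n n')) f ->
  xy_ideal f.
Proof.
set S := image_pred (@lshift n n'); set T := image_pred (@rshift n n').
move=> /vanish_decomp[F [-> FE]] fT.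
have iX := ideal_gen_ideal (fun f : PS k (n + n') => exists i j,
  f = psmul (psX k (lshift n' i)) (psX k (rshift n j))).
apply: ideal_sum => // i /codomP[i' iE].
have FT : vanish T (F i).
  move=> a a0; have [->|//] := FE i a; apply: fT => j Tj; rewrite ffunE a0 // ffunE.
  have /codomP[j' ->] := Tj; rewrite iE; case: eqP => // /(congr1 val) /= e.
  by have := ltn_ord i'; rewrite -e ltnNge leq_addr.
have [G [-> _]] := vanish_decomp FT; rewrite big_distrr /=.
apply: ideal_sum => // j /codomP[j' jE]; rewrite mulrA mulrC.
case: iX => _ _; apply; apply: ideal_gen_mem; exists i', j'; by rewrite iE jE.
Qed.

(** * Free resolutions as complexes of matrices *)

Section Resolutions.
Variables (k : fieldType) (N : nat) (J : PS k N -> Prop) (r : free_res J).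

Definition res_cplx : cplx (PS k N) :=
  @Cplx (PS k N) (fr_rank r) (fun i => \matrix_(a, b) fr_d r i a b).

Lemma rowmulE m q (v : 'I_m -> PS k N) (D : 'I_m -> 'I_q -> PS k N) j :
  rowmul v D j = ((\row_i v i) *m (\matrix_(a, b) D a b)) 0 j.
Proof. by rewrite /rowmul pssumE mxE; apply: eq_bigr => i _; rewrite !mxE. Qed.

Lemma res_exact i (u : 'rV_(rk res_cplx i.+1)) :
  u *m dif res_cplx i = 0 <-> exists w, u = w *m dif res_cplx i.+1.
Proof.
have uE : \row_j u 0 j = u by apply/rowP=> j; rewrite mxE.
have [H1 H2] := @fr_exact k N J r i (u 0); split=> [e|[w e]].
  have [|w wE] := H1; first by move=> j; rewrite rowmulE uE e mxE.
  by exists (\row_i w i); apply/rowP=> j; rewrite wE rowmulE.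
apply/rowP=> j; rewrite [RHS]mxE -uE -rowmulE; apply: H2; exists (w 0) => l.
rewrite e rowmulE; congr (fun_of_matrix (_ *m _) _ _); by apply/rowP=> x; rewrite mxE.
Qed.

Lemma res_is_cplx : is_cplx res_cplx.
Proof.
case=> [|i]; first exact: mulmx0.
apply/row_matrixP=> j; rewrite row_mul row0.
by apply/(res_exact (i := i)); exists (delta_mx 0 j); rewrite -rowE.
Qed.

Lemma res_acyclic : acyclic res_cplx.
Proof. by move=> i u /res_exact. Qed.

Lemma res_rk0 : rk res_cplx 0 = 1%N.
Proof. exact: fr_rank0. Qed.

Lemma aug_res f : aug_ideal res_cplx f <-> J f.
Proof.
have [H1 H2] := @fr_aug k N J r f; split=> [[w wE]|/H1[v vE]].
  apply: H2; exists (w 0) => j; rewrite rowmulE.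
  have -> : \row_i w 0 i = w by apply/rowP=> x; rewrite mxE.
  by have /rowP/(_ j) := wE; rewrite mxE.
by exists (\row_i v i); apply/rowP=> j; rewrite mxE -rowmulE vE.
Qed.

Lemma betti_hdim i : betti r i = hdim (red (@eps k N) res_cplx) i.
Proof.
have redE j : fr_red r j = map_mx (@eps k N) (dif res_cplx j).
  by apply/matrixP=> a b; rewrite !mxE.
case: i => [|i] /=; rewrite /hdim /cyc /= !redE // mxrank_ker mxrank0 subn0 //.
Qed.

End Resolutions.

(** * Integer series and Koszul factors *)

Section Series.

Lemma coef_1X m i : ((1 + 'X) ^+ m : {poly int})`_i = 'C(m, i)%:R.
Proof.
elim: m i => [|m IH] i; first by rewrite expr0 coef1; case: i.
rewrite exprS mulrDl mul1r coefD coefXM !IH; case: i => [|i] /=; first by rewrite !bin0 addr0.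
by rewrite binS natrD.
Qed.

Lemma ser_mul_1X (P : {poly int}) a i :
  ser_mul (poly_ser ((1 + 'X) * P)) a i =
  ser_mul (poly_ser P) a i + (if i is j.+1 then ser_mul (poly_ser P) a j else 0).
Proof.
rewrite /ser_mul /poly_ser.
under eq_bigr do rewrite mulrDl mul1r coefD mulrDl coefXM.
rewrite big_split /=; congr (_ + _); case: i => [|i].
  by rewrite big_ord1 mul0r.
rewrite big_ord_recl /= mul0r add0r; apply: eq_bigr => j _.
by rewrite /bump /= add1n subSS.
Qed.

Lemma ser_mul_X a i :
  ser_mul (poly_ser 'X) a i = if i is j.+1 then a j else 0.
Proof.
rewrite /ser_mul /poly_ser; case: i => [|i]; first by rewrite big_ord1 coefX mul0r.
rewrite 2!big_ord_recl !coefX /= mul0r add0r mul1r subn1 big1 ?addr0 // => j _.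
by rewrite coefX /bump /= mul0r.
Qed.

Lemma hdim_kos (R : comNzRingType) (k : fieldType) (ep : {rmorphism R -> k})
    (C : cplx R) m (z : 'cV[R]_m) i : is_cplx C -> (forall j, ep (z j 0) = 0) ->
  (hdim (red ep (kos C z)) i)%:Z =
  ser_mul (poly_ser ((1 + 'X) ^+ m)) (fun j => (hdim (red ep C) j)%:Z) i.
Proof.
move=> cC; elim: m z i => [|m IH] z i ez.
  rewrite expr0 /ser_mul /poly_ser big_ord_recl coef1 mul1r subn0 big1 ?addr0 // => j _.
  by rewrite coef1 mul0r.
rewrite exprS ser_mul_1X kosS hdim_cone_scalar //; last exact: kos_cplx.
have ez' j : ep (dsubmx (z : 'cV_(1 + m)) j 0) = 0 by rewrite mxE ez.
by rewrite PoszD IH //; case: i => [|i] //=; rewrite IH.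
Qed.

End Series.

(** * Intersection and sum of the ideals of S and T *)

Section FiberIdeals.
Variables (k : fieldType) (n n' : nat) (I : PS k n -> Prop) (I' : PS k n' -> Prop).
Hypotheses (I0 : forall f, I f -> eps f = 0) (I0' : forall f, I' f -> eps f = 0).
Let SX := image_pred (@lshift n n').
Let SY := image_pred (@rshift n n').

Lemma lshift_rshift (i : 'I_n) (j : 'I_n') : lshift n' i <> rshift n j.
Proof. by move/(congr1 val) => /= e; have := ltn_ord i; rewrite e ltnNge leq_addr. Qed.

Lemma ext_x_vanish f : @ext_ideal_x k n n' I f -> vanish SX f.
Proof. by apply: (@ext_ideal_vanish k n _ n' (@lshift n n') (@rshift n n') (@ext_x k n
  n')). Qed.

Lemma ext_y_vanish f : @ext_ideal_y k n n' I' f -> vanish SY f.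
Proof. by apply: (@ext_ideal_vanish k n' _ n (@rshift n n') (@lshift n n') (@ext_y k n
  n')). Qed.

Lemma xy_vanish f : @xy_ideal k n n' f -> vanish SX f /\ vanish SY f.
Proof.
move=> xyf; split; move: f xyf; apply: ideal_gen_sub; try exact: vanish_ideal.
  move=> _ [i [j ->]]; rewrite -[psmul _ _]/(psX k (lshift n' i) * psX k (rshift n j)) mulrC.
  case: (vanish_ideal k SX) => _ _; apply; apply: vanish_X; exact: codom_f.
move=> _ [i [j ->]]; case: (vanish_ideal k SY) => _ _; apply.
apply: vanish_X; exact: codom_f.
Qed.

(** The intersection of I + (y) and I' + (x). If f = a + b = c + e are the two decompositions, b - c
    = e - a lies in both (x) and (y), hence in (xy). *)
Lemma fiber_idealE f : fiber_ideal I I' f <->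
  (exists a b, [/\ @ext_ideal_x k n n' I a, vanish SY b & f = a + b]) /\
  (exists a b, [/\ @ext_ideal_y k n n' I' a, vanish SX b & f = a + b]).
Proof.
have iX := vanish_ideal k SX; have iY := vanish_ideal k SY.
have [_ XD _] := iX; have [_ YD _] := iY.
split=> [[_ [c [[a [b [Ia /xy_vanish[bX bY] ->]]] Ic ->]]]|].
  split; first by exists a, (b + c); split=> //;
    [exact: YD (ext_y_vanish Ic) | exact: esym (addrA _ _ _)].
  exists c, (a + b); split=> //; first exact: XD (ext_x_vanish Ia) bX.
  exact: addrC.
move=> [[a [b [Ia bY ->]]] [c [e [Ic eX ace]]]].
have bc : b - c = e - a.
  have -> : b = (c + e) - a by rewrite -[c + e]ace addrC addKr.
  by rewrite addrAC [c + e]addrC addrK.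
have abc : a + b = (a + (b - c)) + c by rewrite -addrA subrK.
exists (a + (b - c)), c; split=> //.
exists a, (b - c); split=> //; apply: xy_idealE.
  by rewrite bc; apply: (ideal_sub (J := vanish SX)) => //; exact: ext_x_vanish.
by apply: (ideal_sub (J := vanish SY)) => //; exact: ext_y_vanish.
Qed.

Lemma eps_vanish N (P : pred 'I_N) (f : PS k N) : vanish P f -> eps f = 0.
Proof. by move=> f0; apply: f0 => i _; rewrite ffunE. Qed.

(** S and T have only the residue field in common: (x) and (y) already add up to the maximal
    ideal. *)
Lemma ext_sum_max f : eps f = 0 <-> exists a b,
  [/\ exists a1 a2, [/\ @ext_ideal_x k n n' I a1, vanish SY a2 & a = a1 + a2],
      exists b1 b2, [/\ @ext_ideal_y k n n' I' b1, vanish SX b2 & b = b1 + b2] & f = a + b].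
Proof.
split=> [/vanishT/vanish_decomp[F [-> _]]|]; last first.
  move=> [_ [_ [[a1 [a2 [/ext_x_vanish/eps_vanish e1 /eps_vanish e2 ->]]]
     [b1 [b2 [/ext_y_vanish/eps_vanish e3 /eps_vanish e4 ->]]] ->]]].
  by rewrite [eps _]rmorphD !rmorphD /= e1 e2 e3 e4 !addr0.
have in_van m (s : 'I_m -> 'I_(n + n')) :
    vanish (image_pred s) (\sum_i psX k (s i) * F (s i)).
  apply: ideal_sum; first exact: vanish_ideal.
  move=> i _; rewrite mulrC; case: (vanish_ideal k (image_pred s)) => _ _; apply.
  by apply: vanish_X; exact: codom_f.
rewrite big_split_ord /= addrC.
exists (\sum_i psX k (rshift n i) * F (rshift n i)), (\sum_i psX k (lshift n' i) * F
  (lshift n' i)).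
split=> //.
  exists 0, (\sum_i psX k (rshift n i) * F (rshift n i)); rewrite add0r; split;
    [|exact: in_van|by []].
  by case: (ideal_gen_ideal (fun f => exists g, I g /\ f = @ext_x k n n' g)).
exists 0, (\sum_i psX k (lshift n' i) * F (lshift n' i)); rewrite add0r; split;
  [|exact: in_van|by []].
by case: (ideal_gen_ideal (fun f => exists g, I' g /\ f = @ext_y k n n' g)).
Qed.

End FiberIdeals.

(** * Joining the parameters in x and in y *)

Section Combine.
Variables (k : fieldType) (n n' : nat).
Variables (zx : 'I_n -> PS k n) (zy : 'I_n' -> PS k n').

Definition join_params : 'cV[PS k (n + n')]_(n + n') :=
  \col_i match split i with inl a => @ext_x k n n' (zx a) | inr b => @ext_y k n n' (zy b) end.

Lemma linpart_ext_x f : linpart (@ext_x k n n' f) = row_mx (linpart f) 0.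
Proof.
apply/rowP=> i; case: (splitP i) => j ij.
  have -> : i = lshift n' j by exact: val_inj.
  rewrite row_mxEl; apply: (@linpart_ext_s _ _ _ _ (@lshift n n') (@rshift n n')) => //.
    exact: lshift_inj.
  exact: lshift_rshift.
have -> : i = rshift n j by exact: val_inj.
rewrite row_mxEr [RHS]mxE; exact: (@linpart_ext_t _ _ _ _ (@lshift n n') (@rshift n n')).
Qed.

Lemma linpart_ext_y f : linpart (@ext_y k n n' f) = row_mx 0 (linpart f).
Proof.
apply/rowP=> i; case: (splitP i) => j ij.
  have -> : i = lshift n' j by exact: val_inj.
  rewrite row_mxEl [RHS]mxE; exact: (@linpart_ext_t _ _ _ _ (@rshift n n') (@lshift n n')).
have -> : i = rshift n j by exact: val_inj.
rewrite row_mxEr; apply: (@linpart_ext_s _ _ _ _ (@rshift n n') (@lshift n n')) => //.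
  exact: rshift_inj.
by move=> a b e; exact: (lshift_rshift (esym e)).
Qed.

Lemma linpart_join : \matrix_(i, j) linpart (join_params i 0) 0 j =
  block_mx (\matrix_(i, j) linpart (zx i) 0 j) 0 0 (\matrix_(i, j) linpart (zy i) 0 j).
Proof.
apply/matrixP=> i j; rewrite [LHS]mxE [join_params i 0]mxE.
case: (split_ordP i) => a ->.
  rewrite linpart_ext_x /block_mx col_mxEu.
  by case: (split_ordP j) => b ->; rewrite ?row_mxEl ?row_mxEr !mxE.
rewrite linpart_ext_y /block_mx col_mxEd.
by case: (split_ordP j) => b ->; rewrite ?row_mxEl ?row_mxEr !mxE.
Qed.

Lemma eps_join : (forall i, eps (zx i) = 0) -> (forall i, eps (zy i) = 0) ->
  forall i, eps (join_params i 0) = 0.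
Proof.
move=> x0 y0 i; rewrite mxE; case: splitP => a _.
  by rewrite (@eps_ext _ _ _ _ (@lshift n n') (@rshift n n')).
by rewrite (@eps_ext _ _ _ _ (@rshift n n') (@lshift n n')).
Qed.

End Combine.

Lemma linpart_X (k : fieldType) N (i : 'I_N) : linpart (psX k i) = delta_mx 0 i.
Proof. by rewrite -[psX k i]mulr1 linpartXM [eps _]rmorph1 scale1r. Qed.

(* When the rows of L are the linear parts of parameters z, this is the ideal
   generated by the z_i for i <> j and by z_j^2. *)
Definition coord_free (k : fieldType) N (L : 'M[k]_N) (j : 'I_N) (f : PS k N) :=
  eps f = 0 /\ exists c, linpart f = c *m L /\ c 0 j = 0.

Lemma coord_free_ideal (k : fieldType) N (L : 'M[k]_N) j : is_ideal (coord_free L j).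
Proof.
split=> [|f g [f0 [c [fL cj]]] [g0 [d [gL dj]]]|r f [f0 [c [fL cj]]]].
- split=> //; exists 0; split; last by rewrite mxE.
  by rewrite mul0mx; apply/rowP=> i; rewrite !mxE.
- split; first by rewrite [eps _]rmorphD /= f0 g0 addr0.
  exists (c + d); rewrite [linpart _]linpartD fL gL mulmxDl; split=> //.
  by rewrite mxE cj dj addr0.
split; first by rewrite [eps _]rmorphM /= f0 mulr0.
exists (eps r *: c); rewrite [linpart _]linpartM // fL -scalemxAl; split=> //.
by rewrite mxE cj mulr0.
Qed.

Section CoordFree.
Variables (k : fieldType) (n n' : nat) (I : PS k n -> Prop) (I' : PS k n' -> Prop).
Variables (Lx : 'M[k]_n) (Ly : 'M[k]_n') (sx : pred 'I_n) (sy : pred 'I_n').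
Hypotheses (I0 : forall f, I f -> eps f = 0) (I0' : forall f, I' f -> eps f = 0).
Hypotheses (Lxu : Lx \in unitmx) (Lyu : Ly \in unitmx).
Hypothesis IL : forall f, I f -> exists c, linpart f = c *m Lx /\ forall j, ~~ sx j -> c 0
  j = 0.
Hypothesis IL' : forall f, I' f -> exists c, linpart f = c *m Ly /\ forall j, ~~ sy j -> c
  0 j = 0.
Let L : 'M[k]_(n + n') := block_mx Lx 0 0 Ly.

Let rowL (c : 'rV_n) (d : 'rV_n') : row_mx c d *m L = row_mx (c *m Lx) (d *m Ly).
Proof. by rewrite mul_row_block !mulmx0 addr0 add0r. Qed.

(** A parameter zx_i outside [sx] does not occur in the linear parts of elements of [I], by the
    choice of parameters, nor in those of the y-variables, as [L] is block diagonal. With [param_sq]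
    this is the condition that [image_kap] asks. *)
Lemma coord_free_x a b i : @ext_ideal_x k n n' I a -> vanish (image_pred (@rshift n n')) b ->
  ~~ sx i -> coord_free L (lshift n' i) (a + b).
Proof.
move=> Ia bY si; have iK := coord_free_ideal L (lshift n' i); have [_ KD KM] := iK.
apply: KD.
  move: a Ia; apply: ideal_gen_sub => // _ [g [Ig ->]]; split.
    by rewrite (@eps_ext _ _ _ _ (@lshift n n') (@rshift n n')) // I0.
  have [c [gL c0]] := IL Ig; exists (row_mx c 0).
  by rewrite rowL linpart_ext_x gL mul0mx row_mxEl c0.
have /(vanish_span _ (@rshift_inj n n'))[w ->] := bY.
rewrite mxE; apply: ideal_sum => // l _; apply: (KM (w 0 l)); rewrite mxE.
split; first exact: eps_X.
exists (row_mx 0 (delta_mx 0 l *m invmx Ly)).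
by rewrite rowL mul0mx mulmxKV // linpart_X -delta_mx_rshift row_mxEl mxE.
Qed.

Lemma coord_free_y a b i : @ext_ideal_y k n n' I' a -> vanish (image_pred (@lshift n n')) b ->
  ~~ sy i -> coord_free L (rshift n i) (a + b).
Proof.
move=> Ia bX si; have iK := coord_free_ideal L (rshift n i); have [_ KD KM] := iK.
apply: KD.
  move: a Ia; apply: ideal_gen_sub => // _ [g [Ig ->]]; split.
    by rewrite (@eps_ext _ _ _ _ (@rshift n n') (@lshift n n')) // I0'.
  have [c [gL c0]] := IL' Ig; exists (row_mx 0 c).
  by rewrite rowL linpart_ext_y gL mul0mx row_mxEr c0.
have /(vanish_span _ (@lshift_inj n n'))[w ->] := bX.
rewrite mxE; apply: ideal_sum => // l _; apply: (KM (w 0 l)); rewrite mxE.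
split; first exact: eps_X.
exists (row_mx (delta_mx 0 l *m invmx Lx) 0).
by rewrite rowL mul0mx mulmxKV // linpart_X -delta_mx_lshift row_mxEr mxE.
Qed.
End CoordFree.

Lemma aug_resE (k : fieldType) N (J : PS k N -> Prop) (r : free_res J) :
  aug_ideal (res_cplx r) = J.
Proof. by apply: funext => f; apply: propext; exact: aug_res. Qed.

(** [w i] is the dimension of the image in Tor_i(k, k). It is the sum of the exterior powers on p +
    n' and on n + q parameters, which meet in the one on p + q. *)
Lemma fiber_hdim (k : fieldType) (n n' : nat)
    (I : PS k n -> Prop) (I' : PS k n' -> Prop) (p q : nat)
    (rF : free_res (fiber_ideal I I'))
    (rA : free_res (@ext_ideal_x k n n' I))
    (rB : free_res (@ext_ideal_y k n n' I')) :
  is_ideal I -> is_ideal I' ->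
  (forall f, I f -> max_ideal f) -> (forall f, I' f -> max_ideal f) ->
  quot_dim (ideal_add I (@max_ideal_sq k n)) (@max_ideal_sq k n) p ->
  quot_dim (ideal_add I' (@max_ideal_sq k n')) (@max_ideal_sq k n') q ->
  let A := kos (res_cplx rA) (\col_j psX k (rshift n j)) in
  let B := kos (res_cplx rB) (\col_j psX k (lshift n' j)) in
  exists w : nat -> nat, forall i,
   (hdim (red (@eps k (n + n')) (res_cplx rF)) i + w i + w i.+1
    = hdim (red (@eps k (n + n')) A) i + hdim (red (@eps k (n + n')) B) i + 'C(n + n', i.+1))%N
   /\ (w i + 'C(p + q, i) = 'C(p + n', i) + 'C(n + q, i))%N.
Proof.
move=> iI iI' Im Im' dI dI' A B.
have I0 f : I f -> eps f = 0 by move/Im/max_idealE.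
have I0' f : I' f -> eps f = 0 by move/Im'/max_idealE.
have [zx [sx [sxp ex Ix Lxu ILx]]] := adapted_params iI I0 dI.
have [zy [sy [syq ey Iy Lyu ILy]]] := adapted_params iI' I0' dI'.
pose z := join_params zx zy.
have ez : forall i, eps (z i 0) = 0 by exact: eps_join.
have Lu : \matrix_(i, j) linpart (z i 0) 0 j \in unitmx.
  by rewrite linpart_join unitmxE det_ublock unitrM -!unitmxE Lxu.
(* The ideal of S contains (y), hence all n' parameters in y besides the p from [I]; symmetrically
   for T. *)
pose sS : pred 'I_(n + n') := fun i => match split i with inl a => sx a | inr _ => true end.
pose sT : pred 'I_(n + n') := fun i => match split i with inl _ => true | inr b => sy b end.
pose D := res_cplx rF; pose Q := kos (triv_cplx (PS k (n + n'))) z.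
have A1 : rk A 0 = 1%N by apply: kos_rk0; exact: res_rk0.
have B1 : rk B 0 = 1%N by apply: kos_rk0; exact: res_rk0.
have Q1 : rk Q 0 = 1%N by exact: kos_rk0.
have cA : is_cplx A by apply: kos_cplx; exact: res_is_cplx.
have cB : is_cplx B by apply: kos_cplx; exact: res_is_cplx.
have cQ : is_cplx Q by apply: kos_cplx; exact: triv_is_cplx.
have rl i j : rshift n i <> lshift n' j by move=> /esym; exact: lshift_rshift.
have aA : acyclic A.
  apply: kos_acyclic; [exact: res_rk0 | exact: res_acyclic | rewrite aug_resE].
  apply: (@ext_regular k n _ n' (@lshift n n') (@rshift n n')) => //; exact: rshift_inj.
have aB : acyclic B.
  apply: kos_acyclic; [exact: res_rk0 | exact: res_acyclic | rewrite aug_resE].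
  apply: (@ext_regular k n' _ n (@rshift n n') (@lshift n n')) => //; exact: lshift_inj.
have aQ : acyclic Q by apply: triv_kos_acyclic; exact: param_regular.
have augA r : aug_ideal A r <->
    exists a b, [/\ @ext_ideal_x k n n' I a, vanish (image_pred (@rshift n n')) b & r = a + b].
  rewrite (aug_kos _ _ (res_rk0 rA)) aug_resE; apply: adjoin_ext; exact: rshift_inj.
have augB r : aug_ideal B r <->
    exists a b, [/\ @ext_ideal_y k n n' I' a, vanish (image_pred (@lshift n n')) b & r = a + b].
  rewrite (aug_kos _ _ (res_rk0 rB)) aug_resE; apply: adjoin_ext; exact: lshift_inj.
have augQ r : aug_ideal Q r <-> eps r = 0.
  by rewrite aug_triv_kos; exact: param_gen.
have JD r : aug_ideal D r <-> aug_ideal A r /\ aug_ideal B r.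
  by rewrite /D aug_resE augA augB; exact: fiber_idealE.
have JQ r : aug_ideal Q r <-> exists a b, [/\ aug_ideal A a, aug_ideal B b & r = a + b].
  rewrite augQ (ext_sum_max I0 I0'); split=> -[a [b [Ja Jb ->]]]; exists a, b.
    by split=> //; [apply/augA | apply/augB].
  by split=> //; [apply/augA | apply/augB].
have mQ : minimal (@eps k (n + n')) Q by exact: minimal_kos.
have AQ r : aug_ideal A r -> aug_ideal Q r.
  by move=> Ar; apply/JQ; exists r, 0; split; rewrite ?addr0 //; exists 0;
    rewrite mul0mx raddf0.
have BQ r : aug_ideal B r -> aug_ideal Q r.
  by move=> Br; apply/JQ; exists 0, r; split; rewrite ?add0r //; exists 0;
    rewrite mul0mx raddf0.
have [phi [phi0 phiC]] := lift_one cA aQ A1 AQ.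
have [psi [psi0 psiC]] := lift_one cB aQ B1 BQ.
have rz := param_regular ez Lu; have rsq j := param_regular_sq ez Lu j.
have imA i : (cyc (red (@eps k (n + n')) A) i *m map_mx (@eps k (n + n')) (phi i)
    :=: kap (rk (triv_cplx k)) (bitcol k sS) i)%MS.
  apply: (image_kap cA aA A1 ez rz) => //.
    move=> j; rewrite /sS [z j 0]mxE; case: (split_ordP j) => a _.
      move=> /Ix Ia; apply/augA; exists (@ext_x k n n' (zx a)), 0; rewrite addr0; split=> //.
      by apply: ideal_gen_mem; exists (zx a).
    move=> _; apply/augA; exists 0, (@ext_y k n n' (zy a)); rewrite add0r; split=> //.
      by case: (ideal_gen_ideal (fun f => exists g, I g /\ f = @ext_x k n n' g)).
    exact: (@ext_vanish k n' _ n (@rshift n n') (@lshift n n')).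
  move=> j; rewrite /sS; case: (split_ordP j) => a -> // sa r /augA[b [c [Ib cY ->]]].
  have := coord_free_x I0 Lyu ILx Ib cY sa; rewrite -linpart_join => -[e0 [d [dL d0]]].
  exact: (param_sq ez Lu e0 dL d0).
have imB i : (cyc (red (@eps k (n + n')) B) i *m map_mx (@eps k (n + n')) (psi i)
    :=: kap (rk (triv_cplx k)) (bitcol k sT) i)%MS.
  apply: (image_kap cB aB B1 ez rz) => //.
    move=> j; rewrite /sT [z j 0]mxE; case: (split_ordP j) => a _.
      move=> _; apply/augB; exists 0, (@ext_x k n n' (zx a)); rewrite add0r; split=> //.
        by case: (ideal_gen_ideal (fun f => exists g, I' g /\ f = @ext_y k n n' g)).
      exact: (@ext_vanish k n _ n' (@lshift n n') (@rshift n n')).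
    move=> /Iy Ia; apply/augB; exists (@ext_y k n n' (zy a)), 0; rewrite addr0; split=> //.
      by apply: ideal_gen_mem; exists (zy a).
  move=> j; rewrite /sT; case: (split_ordP j) => a -> // sa r /augB[b [c [Ib cX ->]]].
  have := coord_free_y I0' Lxu ILy Ib cX sa; rewrite -linpart_join => -[e0 [d [dL d0]]].
  exact: (param_sq ez Lu e0 dL d0).
pose w i := \rank (kap (rk (triv_cplx k)) (bitcol k sS) i + kap (rk (triv_cplx k)) (bitcol
  k sT) i)%MS.
exists w => i.
have wE j : \rank (cyc (red (@eps k (n + n')) A) j *m map_mx (@eps k (n + n')) (phi j) +
   cyc (red (@eps k (n + n')) B) j *m map_mx (@eps k (n + n')) (psi j))%MS = w j.
  by rewrite (adds_eqmx (imA j) (imB j)).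
split.
  have := fiber_betti (res_is_cplx rF) cA cB cQ (@res_acyclic _ _ _ rF) aA aB aQ (res_rk0 rF)
    A1 B1 Q1 JD JQ mQ phiC psiC phi0 psi0 i.
  by rewrite !wE [rk Q _]kos_rk_triv.
have sumS : (\sum_j sS j = p + n')%N.
  rewrite big_split_ord /= -sxp; congr (_ + _)%N.
    by apply: eq_bigr => a _; rewrite /sS (unsplitK (inl a)).
  rewrite (eq_bigr (fun=> 1%N)) => [|a _]; last by rewrite /sS (unsplitK (inr a)).
  by rewrite sum1_card card_ord.
have sumT : (\sum_j sT j = n + q)%N.
  rewrite big_split_ord /= -syq; congr (_ + _)%N.
    rewrite (eq_bigr (fun=> 1%N)) => [|a _]; last by rewrite /sT (unsplitK (inl a)).
    by rewrite sum1_card card_ord.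
  by apply: eq_bigr => a _; rewrite /sT (unsplitK (inr a)).
have sumST : (\sum_j (sS j && sT j) = p + q)%N.
  rewrite big_split_ord /= -sxp -syq; congr (_ + _)%N; apply: eq_bigr => a _.
    by rewrite /sS /sT (unsplitK (inl a)) andbT.
  by rewrite /sS /sT (unsplitK (inr a)).
by rewrite -sumS -sumT -sumST; exact: rank_kap_sum.
Qed.

(** Denominators are cleared because they vanish when p = n or q = n'. *)
Theorem theorem3p8 (k : fieldType) (n n' : nat)
  (I : PS k n -> Prop) (I' : PS k n' -> Prop) (p q : nat) :
  is_ideal I -> is_ideal I' ->
  (forall f, I f -> max_ideal f) -> (forall f, I' f -> max_ideal f) ->
  quot_dim (ideal_add I (@max_ideal_sq k n)) (@max_ideal_sq k n) p ->
  quot_dim (ideal_add I' (@max_ideal_sq k n')) (@max_ideal_sq k n') q ->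
  forall (rF : free_res (fiber_ideal I I'))
         (rA : free_res (@ext_ideal_x k n n' I))
         (rB : free_res (@ext_ideal_y k n n' I')),
  forall i : nat,
    ser_mul (poly_ser 'X)
      (fun j => poincare rF j
                - ser_mul (poly_ser ((1 + 'X) ^+ n')) (poincare rA) j
                - ser_mul (poly_ser ((1 + 'X) ^+ n)) (poincare rB) j
                + poly_ser ((1 + 'X) ^+ (n + n')) j) i
    = poly_ser (('X + 1) * (((1 + 'X) ^+ n - (1 + 'X) ^+ p)
                          * ((1 + 'X) ^+ n' - (1 + 'X) ^+ q))) i.
Proof.
move=> iI iI' Im Im' dI dI' rF rA rB i.
have [w wP] := fiber_hdim rF rA rB iI iI' Im Im' dI dI'.
have poinE N (J : PS k N -> Prop) (r : free_res J) :
    poincare r = fun j => (hdim (red (@eps k N) (res_cplx r)) j)%:Z.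
  by apply: funext => j; rewrite /poincare betti_hdim.
have PE : ((1 + 'X) ^+ n - (1 + 'X) ^+ p) * ((1 + 'X) ^+ n' - (1 + 'X) ^+ q)
   = (1 + 'X) ^+ (n + n') - (1 + 'X) ^+ (n + q) - (1 + 'X) ^+ (p + n') + (1 + 'X) ^+ (p + q)
   :> {poly int} by rewrite !exprD; ring.
(* The coefficients of the product are the dimensions of the cokernel in Tor_j(k, k). *)
have coefP j : (((1 + 'X) ^+ n - (1 + 'X) ^+ p) * ((1 + 'X) ^+ n' - (1 + 'X) ^+ q) : {poly
  int})`_j
   = ('C(n + n', j))%:Z - (w j)%:Z.
  rewrite PE !coefD !coefN !coef_1X !natz; have [_] := wP j; lia.
rewrite ser_mul_X /poly_ser mulrDl mul1r coefD coefXM !coefP.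
case: i => [|i] /=.
  (* In degree 0 the image is all of Tor_0(k, k), so the cokernel vanishes and both sides are 0. *)
  by have [_] := wP 0%N; rewrite !bin0; lia.
rewrite coef_1X natz !poinE.
rewrite -(hdim_kos (z := \col_j psX k (rshift n j)) _ (res_is_cplx rA)); last first.
  by move=> j; rewrite mxE; exact: eps_X.
rewrite -(hdim_kos (z := \col_j psX k (lshift n' j)) _ (res_is_cplx rB)); last first.
  by move=> j; rewrite mxE; exact: eps_X.
by have [] := wP i; lia.
Qed.
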